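(* Let $F$ be a local field with $\mathrm{char}(F)\neq 2$, $(V,q)$ a nonzero quadratic $F$-vector space, $G^+:=\mathrm{O}(V)$, and $m\in\mathbb{Z}_{\geq 1}$. Let $$1\to\boldsymbol{\mu}_m\to\widetilde{G^+}\xrightarrow{\mathbf{p}}G^+(F)\to 1$$ be a topological central extension. Let $M^+=\prod_{i=1}^r\mathrm{GL}_{d_i}\times\mathrm{O}(V^\flat)$ (with $r\in\mathbb{Z}_{\geq 0}$, $d_i\in\mathbb{Z}_{\geq 1}$) be a Levi subgroup of $G^+$ with $V^\flat$ nonzero, and let $M=\prod_{i=1}^r\mathrm{GL}_{d_i}\times\mathrm{SO}(V^\flat)$ be its identity component. Let $\widetilde{M^+}:=\mathbf{p}^{-1}(M^+(F))$ and $\tilde M:=\mathbf{p}^{-1}(M(F))$. Pick any $F$-point $\tau$ of $\mathrm{O}(V^\flat)\smallsetminus\mathrm{SO}(V^\flat)$, viewed as an element of $M^+(F)$ (which commutes with every $\mathrm{GL}_{d_i}(F)$). Then $\widetilde{M^+}$ is decomposed if and only if (i) $\tilde M$ is decomposed, and (ii) $\mathrm{comm}(t_i,\tau)=1$ for all $1\leq i\leq r$ and all $t_i$ in the standard maximal torus of $\mathrm{GL}_{d_i}(F)$.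
   Context: A quadratic $F$-vector space is a finite-dimensional $F$-vector space with a non-degenerate symmetric bilinear form; $\mathrm{O}(\cdot)$ and $\mathrm{SO}(\cdot)$ are the orthogonal and special orthogonal groups. $\boldsymbol{\mu}_m=\mu_m(\mathbb{C})$. Levi subgroups $M^+=\prod_{i=1}^r\mathrm{GL}_{d_i}\times\mathrm{O}(V^\flat)$ of $\mathrm{O}(V)$ arise from orthogonal decompositions $V=\bigoplus_{i=1}^r(\ell_i\oplus\ell_i^* )\oplus V^\flat$ with $\ell_i\oplus\ell_i^*$ and $V^\flat$ non-degenerate and $\ell_i,\ell_i^*$ totally isotropic of dimension $d_i$; $\mathrm{GL}_{d_i}$ acts on $\ell_i\oplus\ell_i^*$. For commuting $h_1,h_2\in G^+(F)$, $\mathrm{comm}(h_1,h_2):=\tilde h_1\tilde h_2\tilde h_1^{-1}\tilde h_2^{-1}\in\boldsymbol{\mu}_m$, for any preimages $\tilde h_i\in\widetilde{G^+}$ of $h_i$. For topological central extensions $\mathcal{E}_i$ of locally compact groups $H_i$ by $\boldsymbol{\mu}_m$ ($1\leq i\leq k$), the external Baer sum $\mathcal{E}_1\dot\boxplus\cdots\dot\boxplus\mathcal{E}_k$ is the push-out of $1\to\boldsymbol{\mu}_m^k\to\prod_i\mathcal{E}_i\to\prod_iH_i\to 1$ along the multiplication $\boldsymbol{\mu}_m^k\to\boldsymbol{\mu}_m$. $\widetilde{M^+}$ (resp. $\tilde M$) is decomposed if it is isomorphic, as a topological central extension of $M^+(F)$ (resp. $M(F)$) by $\boldsymbol{\mu}_m$,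 to the external Baer sum of the preimages in $\widetilde{G^+}$ of $\mathrm{GL}_{d_1}(F),\ldots,\mathrm{GL}_{d_r}(F)$ and $\mathrm{O}(V^\flat)(F)$ (resp. $\mathrm{SO}(V^\flat)(F)$). *)

(* Defs.v *)
From HB Require Import structures.
From mathcomp Require Import all_boot all_order all_algebra.
From mathcomp Require Import sesquilinear generic_quotient complex.
From mathcomp Require Import boolp classical_sets functions reals topology tvs.

Set Implicit Arguments.
Unset Strict Implicit.
Unset Printing Implicit Defensive.

Import Order.TTheory GRing.Theory Num.Theory.
Local Open Scope classical_set_scope.
Local Open Scope ring_scope.

(* Local fields: non-discrete locally compact Hausdorff topological fields,
    so the archimedean fields are included. *)

HB.mixin Record TopologicalZmodule_isLocalField (F : Type)
    & TopologicalZmodule F & GRing.Field F := {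
  field_mul_continuous : continuous (fun x : F * F => x.1 * x.2);
  field_inv_continuous : forall x : F, x != 0 ->
    {for x, continuous (fun y : F => y^-1)};
  field_hausdorff : hausdorff_space F;
  field_locally_compact : locally_compact [set: F];
  field_nondiscrete : ~ open [set (0 : F)]
}.

#[short(type="localFieldType")]
HB.structure Definition LocalField :=
  {F of TopologicalZmodule F & GRing.Field F
      & TopologicalZmodule_isLocalField F}.

(* As for the library's PreTopologicalZmodule, no compatibility is built in;
   it is [topological_group]. *)
#[short(type="preTopologicalGroupType")]
HB.structure Definition PreTopologicalGroup := {G of Topological G & Group G}.

HB.instance Definition _ (G H : preTopologicalGroupType) := Group.on (G * H)%type.

Definition topological_group (G : preTopologicalGroupType) : Prop :=
  continuous (fun x : G * G => (x.1 * x.2)%g) /\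
  continuous (fun x : G => (x^-1)%g).

Definition topological_group_iso (G H : preTopologicalGroupType) (f : G -> H) :
    Prop :=
  [/\ {morph f : x y / (x * y)%g}, continuous f
    & exists g : H -> G, [/\ cancel f g, cancel g f & continuous g]].

Section Subgroup.
Variable G : preTopologicalGroupType.

Record subgroup := Subgroup {
  subgroup_set :> set G;
  subgroup1 : subgroup_set 1%g;
  subgroupF : forall x y,
    subgroup_set x -> subgroup_set y -> subgroup_set (x / y)%g
}.

Definition subgroup_type (H : subgroup) : Type := set_type (subgroup_set H).

HB.instance Definition _ (H : subgroup) :=
  SubType.copy (subgroup_type H) (set_type H).
HB.instance Definition _ (H : subgroup) :=
  Topological.copy (subgroup_type H) (set_type H).

Variable H : subgroup.

Lemma subgroupV x : subgroup_set H x -> subgroup_set H (x^-1)%g.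
Proof.
by move=> Hx; rewrite -[(x^-1)%g]mul1g; apply: subgroupF => //; apply: subgroup1.
Qed.

Lemma subgroupM x y : subgroup_set H x -> subgroup_set H y -> subgroup_set H (x * y)%g.
Proof. by move=> Hx /subgroupV Hy; rewrite -[y]invgK; apply: subgroupF. Qed.

Lemma subgroup_valP (x : subgroup_type H) : subgroup_set H (\val x).
Proof. exact: set_mem (valP x). Qed.

Definition mem_subgroup x (Hx : subgroup_set H x) : subgroup_type H :=
  exist _ x (mem_set Hx).

Definition subgroup_one := mem_subgroup (subgroup1 H).
Definition subgroup_inv (x : subgroup_type H) :=
  mem_subgroup (subgroupV (subgroup_valP x)).
Definition subgroup_mul (x y : subgroup_type H) :=
  mem_subgroup (subgroupM (subgroup_valP x) (subgroup_valP y)).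

Fact subgroup_mulA : associative subgroup_mul.
Proof. by move=> x y z; apply: val_inj; apply: mulgA. Qed.
Fact subgroup_mul1 : left_id subgroup_one subgroup_mul.
Proof. by move=> x; apply: val_inj; apply: mul1g. Qed.
Fact subgroup_mulr1 : right_id subgroup_one subgroup_mul.
Proof. by move=> x; apply: val_inj; apply: mulg1. Qed.
Fact subgroup_mulV : left_inverse subgroup_one subgroup_inv subgroup_mul.
Proof. by move=> x; apply: val_inj; apply: mulVg. Qed.
Fact subgroup_mulrV : right_inverse subgroup_one subgroup_inv subgroup_mul.
Proof. by move=> x; apply: val_inj; apply: mulgV. Qed.

HB.instance Definition _ := isGroup.Build (subgroup_type H) subgroup_mulA
  subgroup_mul1 subgroup_mulr1 subgroup_mulV subgroup_mulrV.

End Subgroup.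

Section ProductGroup.
Variables (I : Type) (G : I -> preTopologicalGroupType).

Definition prod_group : Type := prod_topology (fun i => G i).

HB.instance Definition _ :=
  Topological.copy prod_group (prod_topology (fun i => G i)).

Let prod_one : prod_group := fun i => 1%g.
Let prod_inv (x : prod_group) : prod_group := fun i => ((x i)^-1)%g.
Let prod_mul (x y : prod_group) : prod_group := fun i => (x i * y i)%g.

Fact prod_mulA : associative prod_mul.
Proof. by move=> x y z; apply: functional_extensionality_dep => i; apply: mulgA. Qed.
Fact prod_mul1 : left_id prod_one prod_mul.
Proof. by move=> x; apply: functional_extensionality_dep => i; apply: mul1g. Qed.
Fact prod_mulr1 : right_id prod_one prod_mul.
Proof. by move=> x; apply: functional_extensionality_dep => i; apply: mulg1. Qed.
Fact prod_mulV : left_inverse prod_one prod_inv prod_mul.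
Proof. by move=> x; apply: functional_extensionality_dep => i; apply: mulVg. Qed.
Fact prod_mulrV : right_inverse prod_one prod_inv prod_mul.
Proof. by move=> x; apply: functional_extensionality_dep => i; apply: mulgV. Qed.

HB.instance Definition _ := isGroup.Build prod_group prod_mulA
  prod_mul1 prod_mulr1 prod_mulV prod_mulrV.

End ProductGroup.

Section Mu.
Variables (R : realType) (m : nat).

Record mu := Mu {
  mu_val : R[i];
  mu_valP : (mu_val \is a GRing.unit) && (mu_val ^+ m == 1)
}.

HB.instance Definition _ := [isSub for mu_val].
HB.instance Definition _ := [Choice of mu by <:].
HB.instance Definition _ := Topological.copy mu (discrete_topology mu).

Fact mu_one_subproof : ((1 : R[i]) \is a GRing.unit) && ((1 : R[i]) ^+ m == 1).
Proof. by rewrite unitr1 expr1n eqxx. Qed.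
Fact mu_inv_subproof (x : mu) :
  ((mu_val x)^-1 \is a GRing.unit) && ((mu_val x)^-1 ^+ m == 1).
Proof.
by case: x => x /= /andP[ux /eqP xm]; rewrite unitrV ux exprVn xm invr1 eqxx.
Qed.
Fact mu_mul_subproof (x y : mu) :
  (mu_val x * mu_val y \is a GRing.unit) && ((mu_val x * mu_val y) ^+ m == 1).
Proof.
case: x y => [x /= /andP[ux /eqP xm]] [y /= /andP[uy /eqP ym]].
by rewrite unitrM ux uy exprMn xm ym mulr1 eqxx.
Qed.

Definition mu_one := Mu mu_one_subproof.
Definition mu_inv x := Mu (mu_inv_subproof x).
Definition mu_mul x y := Mu (mu_mul_subproof x y).

Fact mu_mulA : associative mu_mul.
Proof. by move=> x y z; apply: val_inj; apply: mulrA. Qed.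
Fact mu_mul1 : left_id mu_one mu_mul.
Proof. by move=> x; apply: val_inj; apply: mul1r. Qed.
Fact mu_mulr1 : right_id mu_one mu_mul.
Proof. by move=> x; apply: val_inj; apply: mulr1. Qed.
Fact mu_mulV : left_inverse mu_one mu_inv mu_mul.
Proof. by move=> x; apply: val_inj; case: x => x /= /andP[ux _]; apply: mulVr. Qed.
Fact mu_mulrV : right_inverse mu_one mu_inv mu_mul.
Proof. by move=> x; apply: val_inj; case: x => x /= /andP[ux _]; apply: mulrV. Qed.

HB.instance Definition _ :=
  isGroup.Build mu mu_mulA mu_mul1 mu_mulr1 mu_mulV mu_mulrV.

Lemma mu_mulC (x y : mu) : (x * y = y * x)%g.
Proof. by apply: val_inj; apply: mulrC. Qed.

End Mu.

Record central_ext (A H : preTopologicalGroupType) := CentralExt {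
  ext_total :> preTopologicalGroupType;
  ext_inj : A -> ext_total;
  ext_prj : ext_total -> H;
  ext_injM : {morph ext_inj : a b / (a * b)%g};
  ext_prjM : {morph ext_prj : x y / (x * y)%g};
  ext_inj_injective : injective ext_inj;
  ext_prj_surjective : forall h, exists x, ext_prj x = h;
  ext_exact : forall x, ext_prj x = 1%g <-> exists a, ext_inj a = x;
  ext_central : forall a x, commute (ext_inj a) x
}.

(* [ext_inj] is a homeomorphism onto a closed subgroup, and [ext_prj] identifies
   H with the topological quotient. *)
Definition topological_ext (A H : preTopologicalGroupType)
    (E : central_ext A H) : Prop :=
  [/\ topological_group E,
      continuous (@ext_inj _ _ E),
      forall C : set A, closed C -> closed (@ext_inj _ _ E @` C),
      continuous (@ext_prj _ _ E)
    & forall U : set E, open U -> open (@ext_prj _ _ E @` U)].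

Section Preimage.
Variables (A G : preTopologicalGroupType) (E : central_ext A G) (K : subgroup G).

Lemma ext_prj1 : ext_prj (1%g : E) = 1%g.
Proof.
have e : ext_prj (1%g : E) = (ext_prj (1%g : E) * ext_prj (1%g : E))%g.
  by rewrite -ext_prjM mulg1.
by rewrite -(mulgV (ext_prj (1%g : E))) {2}e -mulgA mulgV mulg1.
Qed.

Lemma ext_inj1 : ext_inj E 1%g = 1%g.
Proof.
have e : ext_inj E 1%g = (ext_inj E 1%g * ext_inj E 1%g)%g.
  by rewrite -ext_injM mulg1.
by rewrite -(mulgV (ext_inj E 1%g)) {2}e -mulgA mulgV mulg1.
Qed.

Lemma ext_prjF (x y : E) : ext_prj (x / y)%g = (ext_prj x / ext_prj y)%g.
Proof.
rewrite ext_prjM; congr (_ * _)%g; apply: (mulIg (ext_prj y)).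
by rewrite -ext_prjM !mulVg ext_prj1.
Qed.

Fact preimage1 : (@ext_prj _ _ E @^-1` K) 1%g.
Proof. by rewrite /preimage /= ext_prj1; apply: subgroup1. Qed.
Fact preimageF x y : (@ext_prj _ _ E @^-1` K) x -> (@ext_prj _ _ E @^-1` K) y ->
  (@ext_prj _ _ E @^-1` K) (x / y)%g.
Proof. by rewrite /preimage /= ext_prjF; apply: subgroupF. Qed.

Definition preimage_subgroup : subgroup E := Subgroup preimage1 preimageF.

Fact preimage_inj_subproof a : subgroup_set preimage_subgroup (ext_inj E a).
Proof.
rewrite /preimage_subgroup /= /preimage /=.
have /ext_exact -> : exists b, ext_inj E b = ext_inj E a by exists a.
exact: subgroup1.
Qed.

Let preimage_inj a : subgroup_type preimage_subgroup :=
  mem_subgroup (preimage_inj_subproof a).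
Let preimage_prj (x : subgroup_type preimage_subgroup) : subgroup_type K :=
  mem_subgroup (subgroup_valP x 
    : subgroup_set K (ext_prj (\val x))).

Fact preimage_injM : {morph preimage_inj : a b / (a * b)%g}.
Proof. by move=> a b; apply: val_inj; apply: ext_injM. Qed.
Fact preimage_prjM : {morph preimage_prj : a b / (a * b)%g}.
Proof. by move=> a b; apply: val_inj; apply: ext_prjM. Qed.
Fact preimage_inj_injective : injective preimage_inj.
Proof. by move=> a b /(congr1 \val) /= /ext_inj_injective. Qed.
Fact preimage_prj_surjective h : exists x, preimage_prj x = h.
Proof.
have [x xh] := ext_prj_surjective E (\val h).
have Kx : subgroup_set preimage_subgroup x.
  by rewrite /preimage_subgroup /= /preimage /= xh; apply: subgroup_valP.
by exists (mem_subgroup Kx); apply: val_inj.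
Qed.
Fact preimage_exact x : preimage_prj x = 1%g <-> exists a, preimage_inj a = x.
Proof.
split=> [/(congr1 \val) /= /ext_exact [a ax]|[a <-]].
  by exists a; apply: val_inj.
by apply: val_inj; apply/ext_exact; exists a.
Qed.
Fact preimage_central a x : commute (preimage_inj a) x.
Proof. by apply: val_inj; apply: ext_central. Qed.

Definition preimage_ext :
    central_ext A (subgroup_type K : preTopologicalGroupType) :=
  CentralExt preimage_injM preimage_prjM preimage_inj_injective
    preimage_prj_surjective preimage_exact preimage_central.

End Preimage.

(* The external Baer sum: the push-out of the product extension along the
    multiplication map, i.e. the quotient of mu x prod_i E_i by the image of
    a |-> ((prod_i a_i)^-1, (a_i)_i), with the quotient topology. *)

Section BaerSum.
Variables (R : realType) (m : nat) (I : finType).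
Variables (H : I -> preTopologicalGroupType).
Variable E : forall i, central_ext (mu R m) (H i).

Local Open Scope quotient_scope.

Let prodE := prod_group (fun i => E i).
Let pre := (mu R m * prodE)%type.

Let amalg (a : I -> mu R m) : pre :=
  (((\prod_i a i)^-1)%g, fun i => ext_inj (E i) (a i)).

Lemma mu_prodM (a b : I -> mu R m) :
  (\prod_i (a i * b i) = \prod_i a i * \prod_i b i)%g.
Proof.
elim/big_rec3: _ => [|i x y z _ ->]; first by rewrite mulg1.
by rewrite -!mulgA; congr (_ * _)%g; rewrite !mulgA (mu_mulC (b i)).
Qed.

Lemma mu_prodV (a : I -> mu R m) : (\prod_i (a i)^-1 = (\prod_i a i)^-1)%g.
Proof.
apply: (mulIg (\prod_i a i)%g); rewrite -mu_prodM mulVg.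
by rewrite big1 // => i _; rewrite mulVg.
Qed.

Lemma amalgM a b : (amalg (fun i => a i * b i) = amalg a * amalg b)%g.
Proof.
congr pair; first by rewrite mu_prodM invgM mu_mulC.
by apply: functional_extensionality_dep => i; apply: ext_injM.
Qed.

Lemma amalg1 : amalg (fun=> 1%g) = 1%g.
Proof.
congr pair; first by rewrite big1 // invg1.
by apply: functional_extensionality_dep => i; apply: ext_inj1.
Qed.

Lemma amalgC a (u : pre) : (amalg a * u = u * amalg a)%g.
Proof.
congr pair; first exact: mu_mulC.
by apply: functional_extensionality_dep => i; apply: ext_central.
Qed.

Definition baer_rel (u v : pre) : bool := `[< exists a, v = (u * amalg a)%g >].

Fact baer_rel_refl : reflexive baer_rel.
Proof.
by move=> u; apply/asboolP; exists (fun=> 1%g); rewrite amalg1 mulg1.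
Qed.

Lemma amalgV a : (amalg a * amalg (fun i => (a i)^-1) = 1)%g.
Proof.
rewrite -amalgM -amalg1; congr amalg.
by apply: functional_extensionality_dep => i; rewrite mulgV.
Qed.

Fact baer_rel_sym : symmetric baer_rel.
Proof.
by move=> u v; apply/asboolP/asboolP => -[a ->];
  exists (fun i => (a i)^-1)%g; rewrite -mulgA amalgV mulg1.
Qed.

Fact baer_rel_trans : transitive baer_rel.
Proof.
move=> v u w /asboolP[a ->] /asboolP[b ->]; apply/asboolP.
by exists (fun i => a i * b i)%g; rewrite amalgM mulgA.
Qed.

Canonical baer_equiv := EquivRel baer_rel baer_rel_refl baer_rel_sym baer_rel_trans.

Definition baer_total : Type := quotient_topology {eq_quot baer_equiv}.

HB.instance Definition _ :=
  Topological.copy baer_total (quotient_topology {eq_quot baer_equiv}).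

Definition baer_pi (u : pre) : baer_total := \pi_({eq_quot baer_equiv}) u.
Definition baer_repr (x : baer_total) : pre := repr (x : {eq_quot baer_equiv}).

Lemma baer_piP u v : baer_pi u = baer_pi v <-> exists a, v = (u * amalg a)%g.
Proof. by split=> [/eqmodP/asboolP //|h]; apply/eqmodP/asboolP. Qed.

Lemma baer_reprK : cancel baer_repr baer_pi.
Proof. exact: reprK. Qed.

Lemma baer_repr_pi u : exists a, baer_repr (baer_pi u) = (u * amalg a)%g.
Proof. by apply/baer_piP; rewrite baer_reprK. Qed.

Let bone : baer_total := baer_pi 1%g.
Let binv (x : baer_total) := baer_pi ((baer_repr x)^-1)%g.
Let bmul (x y : baer_total) := baer_pi (baer_repr x * baer_repr y)%g.

Let bmulE u v : bmul (baer_pi u) (baer_pi v) = baer_pi (u * v)%g.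
Proof.
rewrite /bmul; have [a ->] := baer_repr_pi u; have [b ->] := baer_repr_pi v.
apply/esym/baer_piP; exists (fun i => a i * b i)%g.
by rewrite amalgM !mulgA -(mulgA u) amalgC !mulgA.
Qed.

Let binvE u : binv (baer_pi u) = baer_pi (u^-1)%g.
Proof.
rewrite /binv; have [a ->] := baer_repr_pi u.
by apply/baer_piP; exists a; rewrite invgM -amalgC mulgA mulgV mul1g.
Qed.

Fact baer_mulA : associative bmul.
Proof.
move=> x y z; rewrite -(baer_reprK x) -(baer_reprK y) -(baer_reprK z).
by rewrite !bmulE mulgA.
Qed.
Fact baer_mul1 : left_id bone bmul.
Proof. by move=> x; rewrite -(baer_reprK x) bmulE mul1g. Qed.
Fact baer_mulr1 : right_id bone bmul.
Proof. by move=> x; rewrite -(baer_reprK x) bmulE mulg1. Qed.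
Fact baer_mulV : left_inverse bone binv bmul.
Proof. by move=> x; rewrite -(baer_reprK x) binvE bmulE mulVg. Qed.
Fact baer_mulrV : right_inverse bone binv bmul.
Proof. by move=> x; rewrite -(baer_reprK x) binvE bmulE mulgV. Qed.

HB.instance Definition _ := isGroup.Build baer_total baer_mulA
  baer_mul1 baer_mulr1 baer_mulV baer_mulrV.

Lemma baer_piM u v : baer_pi (u * v)%g = (baer_pi u * baer_pi v)%g.
Proof. by rewrite -bmulE. Qed.

Let binj (a : mu R m) : baer_total := baer_pi (a, 1%g).
Let bprj (x : baer_total) : prod_group H := fun i => ext_prj ((baer_repr x).2 i).

Lemma baer_prjE u : bprj (baer_pi u) = fun i => ext_prj (u.2 i).
Proof.
apply: functional_extensionality_dep => i; rewrite /bprj.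
have [a ->] := baer_repr_pi u.
have /ext_exact ea : exists b, ext_inj (E i) b = ext_inj (E i) (a i) by exists (a i).
by rewrite [ext_prj _]ext_prjM ea mulg1.
Qed.

Fact baer_injM : {morph binj : a b / (a * b)%g}.
Proof. by move=> a b; rewrite /binj -baer_piM; congr (baer_pi (_, _)); rewrite mulg1. Qed.
Fact baer_prjM : {morph bprj : x y / (x * y)%g}.
Proof.
move=> x y; rewrite -(baer_reprK x) -(baer_reprK y) -baer_piM !baer_prjE.
by apply: functional_extensionality_dep => i; apply: ext_prjM.
Qed.
Fact baer_inj_injective : injective binj.
Proof.
move=> a b /baer_piP[c [-> e]].
have c1 i : c i = 1%g.
  apply: (@ext_inj_injective _ _ (E i)); rewrite ext_inj1.
  by rewrite -[LHS]mul1g; apply: (esym (congr1 (fun f : prodE => f i) e)).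
by rewrite big1 // invg1 mulg1.
Qed.
Fact baer_prj_surjective h : exists x, bprj x = h.
Proof.
pose x i := sval (cid (ext_prj_surjective (E i) (h i))).
exists (baer_pi (1%g, x)); rewrite baer_prjE.
apply: functional_extensionality_dep => i.
exact: (svalP (cid (ext_prj_surjective (E i) (h i)))).
Qed.
Fact baer_exact x : bprj x = 1%g <-> exists a, binj a = x.
Proof.
rewrite -(baer_reprK x); case: (baer_repr x) => b u; rewrite baer_prjE; split.
  move=> e; have h i : exists a, ext_inj (E i) a = u i.
    by apply/ext_exact; apply: (congr1 (fun f : prod_group H => f i) e).
  pose a i := sval (cid (h i)).
  have au i : ext_inj (E i) (a i) = u i := svalP (cid (h i)).
  exists (b * \prod_i a i)%g; apply/baer_piP; exists a.
  congr pair; first by rewrite -mulgA mulgV mulg1.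
  by apply: functional_extensionality_dep => i; rewrite -au [RHS]mul1g.
move=> [a /baer_piP[c [_ ->]]]; apply: functional_extensionality_dep => i /=.
by apply/ext_exact; exists (c i); rewrite -[LHS]mul1g.
Qed.
Fact baer_central a x : commute (binj a) x.
Proof.
rewrite /commute -(baer_reprK x) /binj -!baer_piM; congr (baer_pi (_, _)).
  exact: mu_mulC.
by rewrite [LHS]mul1g [RHS]mulg1.
Qed.

Definition baer_sum : central_ext (mu R m) (prod_group H) :=
  CentralExt baer_injM baer_prjM baer_inj_injective baer_prj_surjective
    baer_exact baer_central.

End BaerSum.

Section Commutator.
Variables (A H : preTopologicalGroupType) (E : central_ext A H).

(* The default value 1 plays no role when [h1] and [h2] commute: see
   [ext_commP]. *)
Definition ext_comm (h1 h2 : H) : A :=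
  xget 1%g [set a | exists x1 x2 : E, [/\ ext_prj x1 = h1, ext_prj x2 = h2
    & ext_inj E a = (x1 * x2 * x1^-1 * x2^-1)%g]].

Lemma ext_commP (h1 h2 : H) (x1 x2 : E) : commute h1 h2 ->
  ext_prj x1 = h1 -> ext_prj x2 = h2 ->
  ext_inj E (ext_comm h1 h2) = (x1 * x2 * x1^-1 * x2^-1)%g.
Proof.
move=> h12 e1 e2; rewrite /ext_comm; case: xgetP => [a _|]; last first.
  have /ext_exact[a aE] : ext_prj (x1 * x2 * x1^-1 * x2^-1)%g = 1%g.
    by rewrite !ext_prjF ext_prjM e1 e2 h12 mulgK mulgV.
  by move=> /(_ a) []; exists x1, x2.
move=> [y1 [y2 [f1 f2 ->]]].
have kerP (x y : E) : ext_prj x = ext_prj y -> exists c, x = (ext_inj E c * y)%g.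
  move=> e; have /ext_exact[c cE] : ext_prj (x / y)%g = 1%g.
    by rewrite ext_prjF e mulgV.
  by exists c; rewrite cE -mulgA mulVg mulg1.
have conjE c (z : E) : (ext_inj E c * z / ext_inj E c)%g = z.
  by rewrite ext_central mulgK.
have [|c ->] := kerP y1 x1; first by rewrite f1 e1.
have [|d ->] := kerP y2 x2; first by rewrite f2 e2.
have e (z : E) : (ext_inj E c * x1 * z / (ext_inj E c * x1) = x1 * z / x1)%g.
  by rewrite -[RHS](conjE c) invgM !mulgA.
rewrite e -[RHS](conjE d) invgM !mulgA; congr (_ * _ * _ * _ * _)%g.
exact/esym/ext_central.
Qed.

End Commutator.

Section InternalProduct.
Variables (G : preTopologicalGroupType) (I : finType) (H : I -> subgroup G).
Hypothesis H_comm : forall i j, i != j -> forall x y,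
  subgroup_set (H i) x -> subgroup_set (H j) y -> commute x y.

Let comm_prodM (x y : forall i, subgroup_type (H i)) :
  (\prod_i (\val (x i) * \val (y i)) =
   (\prod_i \val (x i)) * (\prod_i \val (y i)))%g.
Proof.
elim: (index_enum I) (index_enum_uniq I) => [|i r IHr] /=.
  by rewrite !big_nil mulg1.
move=> /andP[ir /IHr]; rewrite !big_cons => ->.
have : commute (\val (y i)) (\prod_(j <- r) \val (x j))%g.
  rewrite big_seq; elim/big_rec: _ => [|j z jr]; first by rewrite /commute mulg1 mul1g.
  apply: commuteM; apply: (H_comm _ (subgroup_valP _) (subgroup_valP _)).
  by apply: contraNneq ir => ->.
by rewrite /commute !mulgA -(mulgA (\val (x i))) => ->; rewrite !mulgA.
Qed.

Definition internal_prod_set : set G :=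
  [set g | exists h : prod_group (fun i => subgroup_type (H i)),
     g = (\prod_i \val (h i))%g].

Fact internal_prod1 : internal_prod_set 1%g.
Proof. by exists 1%g; rewrite big1. Qed.

Fact internal_prodF x y :
  internal_prod_set x -> internal_prod_set y -> internal_prod_set (x / y)%g.
Proof.
move=> [h ->] [k ->]; exists (h / k)%g; rewrite comm_prodM; congr (_ * _)%g.
apply: (mulIg (\prod_i \val (k i))%g); rewrite mulVg -comm_prodM big1 // => i _.
by rewrite -[LHS]/(\val ((k i)^-1 * k i)%g) mulVg.
Qed.

Definition internal_prod : subgroup G := Subgroup internal_prod1 internal_prodF.

End InternalProduct.

(* [M] is meant to be the internal product of the [H i]; the target of the
   projection of the Baer sum is identified with [M] through
   (h_i)_i |-> prod_i h_i. *)
Definition decomposed (R : realType) (m : nat) (G : preTopologicalGroupType)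
    (E : central_ext (mu R m) G) (I : finType) (H : I -> subgroup G)
    (M : subgroup G) : Prop :=
  exists f : baer_sum (fun i => preimage_ext E (H i)) -> preimage_ext E M,
    [/\ topological_group_iso f,
        forall a, f (ext_inj _ a) = ext_inj _ a
      & forall x, \val (ext_prj (f x)) = (\prod_i \val (ext_prj x i))%g].

HB.instance Definition _ (F : localFieldType) (U V : vectType F) :=
  Topological.copy 'Hom(U, V) (initial_topology (@VectorInternalTheory.f2mx F U V)).

Section Orthogonal.
Variables (F : localFieldType) (V : vectType F) (q : {symmetric V}).

Record orth := Orth {
  orth_val :> 'End(V);
  orth_valP : (lker orth_val == 0%VS) && `[< isometry q q orth_val >]
}.

HB.instance Definition _ := [isSub for orth_val].
HB.instance Definition _ := [Choice of orth by <:].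
HB.instance Definition _ := Topological.copy orth (initial_topology orth_val).

Lemma orth_ker (g : orth) : lker g == 0%VS.
Proof. by case/andP: (orth_valP g). Qed.

Lemma orth_isom (g : orth) : isometry q q g.
Proof. by case/andP: (orth_valP g) => _ /asboolP. Qed.

Fact orth_one_subproof :
  (lker (\1%VF : 'End(V)) == 0%VS) && `[< isometry q q (\1%VF : 'End(V)) >].
Proof.
apply/andP; split; first by apply/lker0P => u v; rewrite !id_lfunE.
by apply/asboolP => u v; rewrite !id_lfunE.
Qed.

Fact orth_inv_subproof (g : orth) :
  (lker (g^-1)%VF == 0%VS) && `[< isometry q q (g^-1)%VF >].
Proof.
have gK := lker0_lfunVK (orth_ker g).
apply/andP; split; first by apply/lker0P => u v e; rewrite -(gK u) e gK.
by apply/asboolP => u v; rewrite -(orth_isom g) !gK.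
Qed.

Fact orth_mul_subproof (g h : orth) :
  (lker (g \o h)%VF == 0%VS) && `[< isometry q q (g \o h)%VF >].
Proof.
apply/andP; split.
  have /lker0P gI := orth_ker g; have /lker0P hI := orth_ker h.
  by apply/lker0P => u v; rewrite !comp_lfunE => /gI /hI.
by apply/asboolP => u v; rewrite !comp_lfunE !orth_isom.
Qed.

Definition orth_one := Orth orth_one_subproof.
Definition orth_inv g := Orth (orth_inv_subproof g).
Definition orth_mul g h := Orth (orth_mul_subproof g h).

Fact orth_mulA : associative orth_mul.
Proof. by move=> x y z; apply: val_inj; apply: comp_lfunA. Qed.
Fact orth_mul1 : left_id orth_one orth_mul.
Proof. by move=> x; apply: val_inj; apply: comp_lfun1l. Qed.
Fact orth_mulr1 : right_id orth_one orth_mul.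
Proof. by move=> x; apply: val_inj; apply: comp_lfun1r. Qed.
Fact orth_mulV : left_inverse orth_one orth_inv orth_mul.
Proof. by move=> x; apply: val_inj; apply: lker0_compVf (orth_ker x). Qed.
Fact orth_mulrV : right_inverse orth_one orth_inv orth_mul.
Proof. by move=> x; apply: val_inj; apply: lker0_compfV (orth_ker x). Qed.

HB.instance Definition _ := isGroup.Build orth orth_mulA
  orth_mul1 orth_mulr1 orth_mulV orth_mulrV.

End Orthogonal.

(* The determinant of the restriction of [g] to a [g]-stable subspace [U]. *)
Definition det_on (F : fieldType) (V : vectType F) (U : {vspace V}) (g : 'End(V)) : F :=
  \det (\matrix_(i < \dim U, j < \dim U) coord (vbasis U) j (g (vbasis U)`_i)).

Lemma det_onM (F : fieldType) (V : vectType F) (U : {vspace V}) (g h : 'End(V)) :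
  (g @: U <= U)%VS -> (h @: U <= U)%VS ->
  det_on U (g \o h)%VF = det_on U g * det_on U h.
Proof.
move=> gU hU; rewrite mulrC -det_mulmx; congr (\det _).
apply/matrixP => i j; rewrite !mxE comp_lfunE.
have hi : h (vbasis U)`_i \in U.
  apply: (subvP hU); apply: memv_img; apply: vbasis_mem.
  by rewrite mem_nth // size_tuple.
rewrite {1}(coord_vbasis hi) !linear_sum /=.
by apply: eq_bigr => k _; rewrite !linearZ /= !mxE.
Qed.

Lemma det_on1 (F : fieldType) (V : vectType F) (U : {vspace V}) :
  det_on U (\1%VF : 'End(V)) = 1.
Proof.
rewrite -[RHS](det1 F (\dim U)); congr (\det _); apply/matrixP => i j.
by rewrite !mxE id_lfunE coord_free ?(basis_free (vbasisP U)) // eq_sym.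
Qed.

Section Levi.
Variables (F : localFieldType) (V : vectType F) (q : {symmetric V}).
Implicit Types (g h : orth q) (U W : {vspace V}).

Definition fixes U g : Prop := {in U, forall v, g v = v}.

(* A decomposition V = (+)_i (ell_i + dual_i) + flat; the basis of ell_i
   identifies GL(ell_i) with GL_{d_i}(F). *)
Record levi := Levi {
  levi_r : nat;
  levi_d : 'I_levi_r -> nat;
  levi_ell : 'I_levi_r -> {vspace V};
  levi_dual : 'I_levi_r -> {vspace V};
  levi_flat : {vspace V};
  levi_basis : forall i, (levi_d i).-tuple V;
  levi_d_gt0 : forall i, (0 < levi_d i)%N;
  levi_basisP : forall i, basis_of (levi_ell i) (levi_basis i);
  levi_dim_dual : forall i, \dim (levi_dual i) = levi_d i;
  levi_direct : directv (\sum_i (levi_ell i + levi_dual i) + levi_flat);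
  levi_full : (\sum_i (levi_ell i + levi_dual i) + levi_flat = fullv)%VS;
  levi_ortho : forall i j, i != j ->
    (levi_ell i + levi_dual i <= orthov q (levi_ell j + levi_dual j))%VS;
  levi_ortho_flat : forall i,
    (levi_ell i + levi_dual i <= orthov q levi_flat)%VS;
  levi_nondeg : forall i, ((levi_ell i + levi_dual i) :&:
    orthov q (levi_ell i + levi_dual i) = 0)%VS;
  levi_nondeg_flat : (levi_flat :&: orthov q levi_flat = 0)%VS;
  levi_isotropic : forall i, (levi_ell i <= orthov q (levi_ell i))%VS;
  levi_isotropic_dual : forall i, (levi_dual i <= orthov q (levi_dual i))%VS
}.

Variable P : levi.
Local Notation plane i := (levi_ell i + levi_dual i)%VS.

Lemma fixes1 U : fixes U 1%g.
Proof. by move=> v _; apply: id_lfunE. Qed.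

Lemma orthVK g v : (g^-1)%g (g v) = v.
Proof. exact: lker0_lfunK (orth_ker g) v. Qed.

Lemma fixesF U g h : fixes U g -> fixes U h -> fixes U (g / h)%g.
Proof.
move=> gU hU v vU; rewrite [LHS]comp_lfunE -{2}(gU v vU); congr (_ _).
by rewrite -{1}(hU v vU); apply: orthVK.
Qed.

Lemma stable1 U : ((1%g : orth q) @: U)%VS = U.
Proof. exact: lim1g. Qed.

Lemma stableF U g h : (g @: U)%VS = U -> (h @: U)%VS = U ->
  ((g / h)%g @: U)%VS = U.
Proof.
move=> gU hU.
have hVU : (orth_val (h^-1)%g @: U)%VS = U.
  by rewrite -{1}hU -limg_comp (lker0_compVf (orth_ker h)) lim1g.
by rewrite [LHS]limg_comp hVU.
Qed.

(* GL_{d_i}(F): it acts on ell_i + dual_i, by restriction to ell_i it is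
   GL(ell_i), and its action on dual_i is then the contragredient one. *)
Definition levi_GL_set (i : 'I_(levi_r P)) : set (orth q) := [set g : orth q |
  [/\ (g @: levi_ell i)%VS = levi_ell i,
      (g @: levi_dual i)%VS = levi_dual i,
      forall j, j != i -> fixes (plane j) g
    & fixes (levi_flat P) g]].

Fact levi_GL1 (i : 'I_(levi_r P)) : levi_GL_set i 1%g.
Proof. by split=> *; do ?[exact: stable1|exact: fixes1]. Qed.
Fact levi_GLF (i : 'I_(levi_r P)) g h :
  levi_GL_set i g -> levi_GL_set i h -> levi_GL_set i (g / h)%g.
Proof.
move=> [g1 g2 g3 g4] [h1 h2 h3 h4].
by split=> [||j ji|]; do ?[exact: stableF]; apply: fixesF; auto.
Qed.
Definition levi_GL (i : 'I_(levi_r P)) : subgroup (orth q) := Subgroup (@levi_GL1 i) (@levi_GLF i).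

Definition levi_O_set : set (orth q) := [set g : orth q |
  (g @: levi_flat P)%VS = levi_flat P /\ forall j : 'I_(levi_r P), fixes (plane j) g].

Fact levi_O1 : levi_O_set 1%g.
Proof. by split=> *; do ?[exact: stable1|exact: fixes1]. Qed.
Fact levi_OF g h : levi_O_set g -> levi_O_set h -> levi_O_set (g / h)%g.
Proof.
move=> [g1 g2] [h1 h2].
by split=> [|j]; do ?[exact: stableF]; apply: fixesF; auto.
Qed.
Definition levi_O : subgroup (orth q) := Subgroup levi_O1 levi_OF.

Definition levi_SO_set : set (orth q) :=
  [set g : orth q | levi_O_set g /\ det_on (levi_flat P) g = 1].

Fact levi_SO1 : levi_SO_set 1%g.
Proof. by split; [exact: levi_O1|exact: det_on1]. Qed.
Fact levi_SOF g h : levi_SO_set g -> levi_SO_set h -> levi_SO_set (g / h)%g.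
Proof.
move=> [gO g1] [hO h1]; split; first exact: levi_OF.
have hVO : levi_O_set (h^-1)%g.
  by rewrite -[(h^-1)%g]mul1g; apply: levi_OF => //; apply: levi_O1.
have hV1 : det_on (levi_flat P) (h^-1)%g = 1.
  have := det_on1 (levi_flat P).
  rewrite -(lker0_compVf (orth_ker h)) det_onM ?(proj1 hO) //; last first.
    by rewrite [X in (X <= _)%VS](proj1 hVO).
  by rewrite h1 mulr1.
by rewrite [LHS]det_onM ?(proj1 gO) ?(proj1 hVO) // g1 hV1 mulr1.
Qed.
Definition levi_SO : subgroup (orth q) := Subgroup levi_SO1 levi_SOF.

(* The family GL_{d_1}(F), ..., GL_{d_r}(F), K. *)
Definition levi_factors (K : subgroup (orth q)) (o : option 'I_(levi_r P)) :
    subgroup (orth q) :=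
  if o is Some i then levi_GL i else K.

Lemma lfun_eq_on U W (f g : 'End(V)) :
  {in U, f =1 g} -> {in W, f =1 g} -> {in (U + W)%VS, f =1 g}.
Proof.
by move=> fU fW _ /memv_addP[u uU [w wW ->]]; rewrite !linearD /= fU ?fW.
Qed.

Lemma levi_eq (f g : 'End(V)) : (forall i : 'I_(levi_r P), {in plane i, f =1 g}) ->
  {in levi_flat P, f =1 g} -> f = g.
Proof.
move=> fp ff; apply/lfunP => v.
have : v \in (\sum_(i < levi_r P) plane i + levi_flat P)%VS by rewrite levi_full memvf.
apply: lfun_eq_on ff v => _ /memv_sumP[u uP ->].
by rewrite !linear_sum; apply: eq_bigr => i _; apply: fp; apply: uP.
Qed.

Lemma levi_GL_stable (i : 'I_(levi_r P)) g : levi_GL_set i g ->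
  forall (j : 'I_(levi_r P)) v, v \in plane j -> g v \in plane j.
Proof.
move=> [g1 g2 g3 _] j v; have [->|/g3 gj] := eqVneq j i; last first.
  by move=> vj; rewrite gj.
move=> /memv_addP[u ul [w wl ->]]; rewrite linearD memv_add //.
  by rewrite -g1 memv_img.
by rewrite -g2 memv_img.
Qed.

Lemma levi_GL_comm (i j : 'I_(levi_r P)) g h : i != j ->
  levi_GL_set i g -> levi_GL_set j h -> commute g h.
Proof.
move=> ij gi hj; apply: val_inj; apply: levi_eq => [k v vk|v vf] /=; last first.
  by rewrite !comp_lfunE; case: gi hj => _ _ _ g4 [_ _ _ h4]; rewrite h4 // g4 // h4.
rewrite !comp_lfunE; have gvk := levi_GL_stable gi vk.
have hvk := levi_GL_stable hj vk.
case: gi hj => _ _ g3 _ [_ _ h3 _].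
have [ki|ki] := eqVneq k i; last by rewrite !(g3 k).
have kj : k != j by rewrite ki.
by rewrite !(h3 k).
Qed.

Lemma levi_GLO_comm (i : 'I_(levi_r P)) g h : levi_GL_set i g -> levi_O_set h -> commute g h.
Proof.
move=> gi hO; apply: val_inj; apply: levi_eq => [k v vk|v vf] /=.
  by rewrite !comp_lfunE (hO.2 k _ vk) (hO.2 k _ (levi_GL_stable gi vk)).
rewrite !comp_lfunE; case: gi => _ _ _ g4; rewrite (g4 v) // g4 //.
by case: hO => <- _; rewrite memv_img.
Qed.

Lemma levi_factors_comm K : subgroup_set K `<=` levi_O_set ->
  forall o p, o != p -> forall g h, subgroup_set (levi_factors K o) g ->
  subgroup_set (levi_factors K p) h -> commute g h.
Proof.
move=> KO [i|] [j|] //= ij g h.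
- by apply: levi_GL_comm; apply: contraNneq ij => ->.
- by move=> gi /KO hO; apply: (levi_GLO_comm gi hO).
- by move=> /KO gO hi; apply/commute_sym; apply: (levi_GLO_comm hi gO).
Qed.

(* The F-points of M^+ = prod_i GL_{d_i} x O(flat) and of its identity
   component. *)
Definition levi_Mplus : subgroup (orth q) :=
  internal_prod (levi_factors_comm (K := levi_O) (fun g (gO : levi_O_set g) => gO)).
Definition levi_M : subgroup (orth q) :=
  internal_prod (levi_factors_comm (K := levi_SO) (fun g (gSO : levi_SO_set g) => gSO.1)).

(* The diagonal matrices in GL_{d_i}(F). *)
Definition levi_torus (i : 'I_(levi_r P)) : set (orth q) := [set t : orth q | levi_GL_set i t /\
  forall j, exists c : F,
    t (tnth (levi_basis i) j) = c *: tnth (levi_basis i) j].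

End Levi.

Arguments levi_factors {F V q} P K o.

(* Main.v *)
(* Decomposability of the preimage of a product of commuting subgroups H_i just
   means that the preimages of distinct H_i commute elementwise.  If they do, the
   product map from the Baer sum is a continuous isomorphism of groups; its
   inverse is continuous because mu_m is discrete, so that the extension has
   continuous local sections, which are composed with the coordinate maps
   M -> H_i.

   It remains to pass from SO(flat) to O(flat), which is SO(flat) together with
   its coset of tau: one has to show that g |-> comm(g, tau) is trivial on GL_d(F)
   as soon as it is trivial on diagonal matrices.  It is multiplicative and
   invariant under conjugation, hence trivial on diagonalizable matrices.  As F
   is infinite, a triangular matrix becomes diagonalizable after multiplication by
   a suitable diagonal matrix; transpositions are diagonalizable because
   2 is invertible; and every invertible matrix is P L U with P a permutation
   matrix and L, U triangular. *)
Require Import Defs.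
From HB Require Import structures.
From mathcomp Require Import all_boot all_order all_algebra.
From mathcomp Require Import fingroup perm ring.
From mathcomp Require Import sesquilinear generic_quotient complex.
From mathcomp Require Import boolp classical_sets functions cardinality.
From mathcomp Require Import reals topology tvs.

Set Implicit Arguments.
Unset Strict Implicit.
Unset Printing Implicit Defensive.

Import GRing.Theory.
Local Open Scope classical_set_scope.
Local Open Scope ring_scope.

(** * Matrices generated by the conjugates of diagonal matrices *)

Section DiagonalizableGeneration.
Variables (F : fieldType) (n : nat).
Hypothesis F_large : exists c : 'I_n.+1 -> F, injective c /\ forall i, c i != 0.

Section Trig.
Variable Pr : 'M[F]_n.+1 -> Prop.
Hypothesis PrM : forall A B, A \in unitmx -> B \in unitmx ->
  Pr A -> Pr B -> Pr (A *m B).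
Hypothesis PrJ : forall P A, P \in unitmx -> A \in unitmx ->
  Pr A -> Pr (invmx P *m A *m P).
Hypothesis Pr_diag : forall d, diag_mx d \in unitmx -> Pr (diag_mx d).

Lemma diagonalizable_ind A : A \in unitmx -> diagonalizable A -> Pr A.
Proof.
move=> Au [P Pu /(diagonalizable_forLR Pu)[d]].
move=> Ad; move: Au; rewrite Ad mxpoly.conjVmx //.
rewrite !unitmx_mul => /andP[/andP[_ du] _]; apply: PrJ => //.
exact: Pr_diag.
Qed.

(* Scaling the rows generically makes the diagonal entries, hence the
   eigenvalues, pairwise distinct. *)
Lemma trigmx_ind A : A \in unitmx -> is_trig_mx A -> Pr A.
Proof.
move=> Au At; have := Au; rewrite unitmxE det_trig // unitfE.
move=> /prodf_neq0 Ad; have [c [cI c0]] := F_large.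
(* Left multiplication by [diag_mx d] turns the diagonal of [A] into [c], and [diag_mx e] undoes
   it. *)
pose d := \row_i (c i / A i i); pose e := \row_i (A i i / c i).
have de : diag_mx e *m diag_mx d = 1%:M.
  rewrite mulmx_diag -diag_const_mx; congr diag_mx; apply/rowP => i.
  by rewrite !mxE mulrA divfK // mulfV // Ad.
have [eu du] := mulmx1_unit de.
have -> : A = diag_mx e *m (diag_mx d *m A) by rewrite mulmxA de mul1mx.
apply: PrM => //; [by rewrite unitmx_mul du|exact: Pr_diag|].
apply: diagonalizable_ind; first by rewrite unitmx_mul du.
have dAt : is_trig_mx (diag_mx d *m A).
  by apply/is_trig_mxP => i j ij; rewrite mul_diag_mx mxE (is_trig_mxP At) ?mulr0.
apply/diagonalizableP; exists (map c (enum 'I_n.+1)).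
  by rewrite map_inj_uniq ?enum_uniq.
apply: dvdp_trans (mxminpoly_dvd_char _) _.
rewrite char_poly_trig // big_map big_enum /=.
rewrite (eq_bigr (fun i => 'X - (c i)%:P)) ?dvdpp // => i _.
by rewrite mul_diag_mx !mxE divfK // Ad.
Qed.

End Trig.

Variable Pr : 'M[F]_n.+1 -> Prop.
Hypothesis charF : 2%N \notin [pchar F].
Hypothesis PrM : forall A B, A \in unitmx -> B \in unitmx ->
  Pr A -> Pr B -> Pr (A *m B).
Hypothesis PrJ : forall P A, P \in unitmx -> A \in unitmx ->
  Pr A -> Pr (invmx P *m A *m P).
Hypothesis Pr_diag : forall d, diag_mx d \in unitmx -> Pr (diag_mx d).

(** Transposition reverses products and turns conjugation by [P] into conjugation by the transpose
    of [invmx P], so [fun B => Pr B^T] satisfies the closure conditions of [trigmx_ind]. *)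
Lemma tr_trigmx_ind A : A \in unitmx -> is_trig_mx A^T -> Pr A.
Proof.
rewrite -unitmx_tr -{3}(trmxK A).
apply: (trigmx_ind (Pr := fun B => Pr B^T)) => [B C Bu Cu PB PC|P B Pu Bu PB|d].
- by rewrite trmx_mul; apply: PrM; rewrite ?unitmx_tr.
- rewrite !trmx_mul mulmxA; have := @PrJ (invmx P)^T B^T.
  by rewrite -trmx_inv invmxK; apply; rewrite ?unitmx_tr ?unitmx_inv.
- by rewrite tr_diag_mx; apply: Pr_diag.
Qed.

(** The matrix is a root of [(X - 1)(X + 1)], whose roots are distinct because 2 is nonzero. *)
Lemma tperm_mx_ind i j : Pr (tperm_mx i j).
Proof.
have t2 : tperm_mx i j *m tperm_mx i j = 1%:M :> 'M[F]_n.+1.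
  by rewrite -perm_mxM tperm2 perm_mx1.
apply: diagonalizable_ind; rewrite ?unitmx_perm //.
have two : (2%:R : F) != 0 by move: charF; rewrite !inE.
apply/diagonalizableP; exists [:: 1; -1].
  by rewrite /= inE -subr_eq0 opprK two.
apply: mxminpoly_min; rewrite !big_cons big_nil mulr1 rmorphM !rmorphB /=.
rewrite !horner_mx_X !horner_mx_C raddfN /= opprK mulrDr mulr1 mulrBl mul1r.
by rewrite -mulmxE t2 addrA subrK subrr.
Qed.

Lemma unitmx_diag_conj_ind A : A \in unitmx -> Pr A.
Proof.
move=> Au.
have Pr_perm s : Pr (perm_mx s).
  have [ts -> _] := prod_tpermP s; elim: ts => [|t ts IH].
    rewrite big_nil perm_mx1 -diag_const_mx; apply: Pr_diag.
    by rewrite diag_const_mx unitmx1.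
  rewrite big_cons perm_mxM; apply: PrM; rewrite ?unitmx_perm //.
  exact: tperm_mx_ind.
have := cormen_lup_perm A; have := cormen_lup_correct A.
have := cormen_lup_detL A.
have := @cormen_lup_lower _ _ A; have := @cormen_lup_upper _ _ A.
case: cormen_lup => [[P L] U] /= Uu Ll detL PA /is_perm_mxP[s Ps].
have Lu : L \in unitmx by rewrite unitmxE detL unitr1.
have PAE : A = perm_mx (s^-1)%g *m (L *m U).
  by rewrite mulmxE -PA Ps -mulmxE mulmxA -perm_mxM mulVg perm_mx1 mul1mx.
have Uun : U \in unitmx by move: Au; rewrite PAE !unitmx_mul => /and3P[].
rewrite PAE; apply: PrM; rewrite ?unitmx_perm ?unitmx_mul ?Lu //.
apply: PrM => //.
  apply: trigmx_ind => //; apply/is_trig_mxP => i j ij.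
  by rewrite Ll ?(ltnW ij) // -val_eqE ltn_eqF.
by apply: tr_trigmx_ind => //; apply/is_trig_mxP => i j ij; rewrite mxE Uu.
Qed.

End DiagonalizableGeneration.

Lemma unitmx_ind (F : fieldType) n (Pr : 'M[F]_n -> Prop) :
    2%N \notin [pchar F] ->
    (exists c : 'I_n -> F, injective c /\ forall i, c i != 0) ->
    (forall A B, A \in unitmx -> B \in unitmx -> Pr A -> Pr B -> Pr (A *m B)) ->
    (forall P A, P \in unitmx -> A \in unitmx -> Pr A -> Pr (invmx P *m A *m P)) ->
    (forall d, diag_mx d \in unitmx -> Pr (diag_mx d)) ->
  forall A, A \in unitmx -> Pr A.
Proof.
case: n Pr => [|n] Pr charF F_large PrM PrJ Pr_diag A Au.
  (* The only matrix of size 0 is diagonal. *)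
  have := Pr_diag 0; rewrite [diag_mx 0]flatmx0 [A]flatmx0 unitmxE det_mx00.
  by rewrite unitr1; apply.
exact: (unitmx_diag_conj_ind F_large charF PrM PrJ Pr_diag).
Qed.

(** * Topological groups and central extensions *)

Lemma initial_cvgP (S : Type) (T : choiceType) (U : topologicalType) (w : T -> U)
    (F : set_system S) (FF : Filter F) (f : S -> initial_topology w)
    (a : initial_topology w) :
  w \o f @ F --> w a -> f @ F --> a.
Proof.
move=> wf A [_ [[B oB <-] Ba BA]].
by apply: (filterS BA); apply: wf; apply: open_nbhs_nbhs.
Qed.

Lemma subgroup_cvg (S : Type) (G : preTopologicalGroupType) (H : subgroup G)
    (F : set_system S) (FF : Filter F) (f : S -> subgroup_type H)
    (a : subgroup_type H) :
  (fun x => \val (f x)) @ F --> \val a -> f @ F --> a.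
Proof. exact: initial_cvgP. Qed.

Lemma subgroup_val_continuous (G : preTopologicalGroupType) (H : subgroup G) :
  continuous (\val : subgroup_type H -> G).
Proof. exact: initial_continuous. Qed.

Lemma prod_group_cvg (S I : Type) (G : I -> preTopologicalGroupType)
    (F : set_system S) (FF : Filter F) (f : S -> prod_group G) (a : prod_group G) :
  (forall i, (fun x => f x i) @ F --> a i) -> f @ F --> a.
Proof. by move=> fa; apply/cvg_sup => i; apply: initial_cvgP; exact: fa. Qed.

Lemma prod_group_proj_continuous (I : Type) (G : I -> preTopologicalGroupType) i :
  continuous (fun x : prod_group G => x i).
Proof.
move=> x; have /cvg_sup/(_ i) xi : x --> x by exact: cvg_id.
move=> A Ax; apply: (xi (_ @^-1` A)).
exact: (@initial_continuous _ _ (fun y : forall i, G i => y i) x A Ax).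
Qed.

Section TopologicalGroup.
Variables (S : Type) (G : preTopologicalGroupType) (Gtop : topological_group G).
Variables (F : set_system S) (FF : Filter F).

Lemma mulg_cvg (f g : S -> G) (a b : G) :
  f @ F --> a -> g @ F --> b -> (fun x => f x * g x)%g @ F --> (a * b)%g.
Proof.
apply: (@continuous2_cvg _ _ _ _ F FF f g (fun x y : G => x * y)%g).
exact: (Gtop.1 (a, b)).
Qed.

Lemma invg_cvg (f : S -> G) (a : G) :
  f @ F --> a -> (fun x => (f x)^-1)%g @ F --> (a^-1)%g.
Proof. by move=> fa; apply: (cvg_comp _ _ fa); exact: Gtop.2. Qed.

Lemma prodg_cvg (I : Type) (r : seq I) (f : I -> S -> G) (a : I -> G) :
  (forall i, f i @ F --> a i) ->
  (fun x => \prod_(i <- r) f i x)%g @ F --> (\prod_(i <- r) a i)%g.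
Proof.
move=> fa; elim: r => [|i r IHr].
  by under eq_fun do rewrite big_nil; rewrite big_nil; exact: cvg_cst.
by under eq_fun do rewrite big_cons; rewrite big_cons; exact: mulg_cvg.
Qed.

End TopologicalGroup.

(** * Local sections of central extensions by discrete groups *)

Section LocalSection.
Variables (A H : preTopologicalGroupType) (E : central_ext A H).

Lemma ext_prj_inj a : ext_prj (ext_inj E a) = 1%g.
Proof. by apply/ext_exact; exists a. Qed.

Lemma ext_prj_eq (x y : E) : ext_prj x = ext_prj y ->
  exists a, x = (ext_inj E a * y)%g.
Proof.
move=> e; have /ext_exact[a aE] : ext_prj (x / y)%g = 1%g.
  by rewrite ext_prjF e mulgV.
by exists a; rewrite aE -mulgA mulVg mulg1.
Qed.

Hypotheses (Etop : topological_ext E) (A_discrete : closed (~` [set 1%g : A])).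

(** The closed map [ext_inj] sends the complement of 1 to a closed set; the complement of that set
    is the neighbourhood. *)
Lemma ext_inj_isolated :
  exists U : set E, nbhs (1%g : E) U /\ forall a, U (ext_inj E a) -> a = 1%g.
Proof.
case: Etop => _ _ injC _ _; exists (~` (@ext_inj _ _ E @` (~` [set 1%g]))); split.
  apply: open_nbhs_nbhs; split; first by apply: closed_openC; exact: injC.
  by move=> [a a1]; rewrite -(ext_inj1 E) => /ext_inj_injective.
by move=> a; apply: contra_notP => a1; exists a.
Qed.

(* Near a point of a discrete central extension the projection is injective and
   open, hence a local homeomorphism. *)
Lemma ext_local_section (x0 : E) : exists s : H -> E,
  [/\ cancel s (@ext_prj _ _ E), s (ext_prj x0) = x0
    & s @ ext_prj x0 --> x0].
Proof.
have [U [U1 Ua]] := ext_inj_isolated; have [Eg _ _ _ prjO] := Etop.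
have dx0 : (fun u : E * E => u.1 / u.2)%g @ (x0, x0) --> (1 : E)%g.
  by rewrite -(mulgV x0); apply: (mulg_cvg Eg);
    [exact: cvg_fst|apply: (invg_cvg Eg); exact: cvg_snd].
have [[B C] [/= Bx Cx] BC] := dx0 U U1.
(* Quotients of points of [W] lie in [U], so two points of [W] with the same projection are
   equal. *)
pose W := B `&` C.
have WI x y : W x -> W y -> ext_prj x = ext_prj y -> x = y.
  move=> [Bx' _] [_ Cy] /ext_prj_eq[a xE].
  have /Ua a1 : U (ext_inj E a).
    by have := BC (x, y) (conj Bx' Cy); rewrite /= xE mulgK.
  by rewrite xE a1 ext_inj1 mul1g.
have Wx0 : nbhs x0 W by exact: filterI.
have sP h : exists x, ext_prj x = h /\ ((exists2 y, W y & ext_prj y = h) -> W x).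
  have [[y Wy yh]|nW] := pselect (exists2 y, W y & ext_prj y = h).
    by exists y.
  by have [x xh] := ext_prj_surjective E h; exists x.
(* [s] selects the point of [W] over [h] when there is one, and an arbitrary lift otherwise. *)
pose s h := sval (cid (sP h)).
have sK h : ext_prj (s h) = h by rewrite /s; case: cid => x [].
have sW y : W y -> s (ext_prj y) = y.
  move=> Wy; apply: (WI (s (ext_prj y)) y _ Wy (sK _)).
  by rewrite /s; case: cid => x [_] /=; apply; exists y.
exists s; split=> //; first by apply: sW; exact: nbhs_singleton.
(* The projection is open, so it sends a neighbourhood inside [N] and [W] to a neighbourhood on
   which [s] inverts it. *)
move=> N Nx0; have /= : nbhs (ext_prj x0) (@ext_prj _ _ E @` (interior (N `&` W))).
  apply: open_nbhs_nbhs; split; first by apply: prjO; exact: open_interior.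
  by exists x0 => //; exact: filterI.
apply: filterS => _ [x /interior_subset[Nx Wx] <-] /=.
by rewrite sW.
Qed.

End LocalSection.

Lemma prodgM_commute (G : groupType) (I : eqType) (r : seq I) (x y : I -> G) :
  uniq r -> (forall i j, i != j -> commute (y i) (x j)) ->
  (\prod_(i <- r) (x i * y i) = \prod_(i <- r) x i * \prod_(i <- r) y i)%g.
Proof.
move=> + xy; elim: r => [|i r IHr] /=; first by rewrite !big_nil mulg1.
move=> /andP[ir /IHr]; rewrite !big_cons => ->.
rewrite !mulgA; congr (_ * _)%g; rewrite -!mulgA; congr (_ * _)%g.
rewrite big_seq; elim/big_rec: _ => [|j z jr IHz]; first by rewrite mulg1 mul1g.
rewrite -mulgA -IHz !mulgA; congr (_ * _)%g; apply: xy.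
by apply: contraNneq ir => ->.
Qed.

Lemma prodg_only (G : groupType) (I : finType) (i : I) (x : I -> G) :
  (forall j, j != i -> x j = 1%g) -> (\prod_j x j = x i)%g.
Proof.
move=> x1; rewrite big_seq_cond.
have : uniq (index_enum I) by exact: index_enum_uniq.
have : i \in index_enum I by rewrite mem_index_enum.
elim: (index_enum I) => // j r IHr; rewrite inE /= -big_seq_cond big_cons.
move=> ij /andP[jr ur].
have [ji|ji] := eqVneq j i.
  rewrite ji big_seq big1 ?mulg1 // => k kr.
  by apply: x1; apply: contraNneq jr => kj; rewrite ji -kj.
rewrite x1 // mul1g big_seq_cond IHr //.
by move: ij; rewrite eq_sym (negPf ji).
Qed.

(** Two lifts of one element differ by a central factor, so whether lifts commute depends only on
    their projections. *)
Lemma commute_ext_prj (A H : preTopologicalGroupType) (E : central_ext A H)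
    (x y x' y' : E) :
  ext_prj x = ext_prj x' -> ext_prj y = ext_prj y' -> commute x' y' -> commute x y.
Proof.
move=> /ext_prj_eq[a ->] /ext_prj_eq[b ->] xy.
apply: commuteM; first exact/commute_sym/ext_central.
apply/commute_sym/commuteM; first exact/commute_sym/ext_central.
exact/commute_sym.
Qed.

Lemma prod_groupM (I : Type) (G : I -> preTopologicalGroupType) (x y : prod_group G) i :
  (x * y)%g i = (x i * y i)%g.
Proof. by []. Qed.

(** * The product map from the Baer sum of the preimages *)

Section Decomposed.
Local Open Scope quotient_scope.
Variables (R : realType) (m : nat) (G : preTopologicalGroupType).
Variables (E : central_ext (mu R m) G) (I : finType) (H : I -> subgroup G).
Local Notation Ei := (fun i => preimage_ext E (H i)).
Local Notation Fi := (fun i => Ei i : preTopologicalGroupType).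
Local Notation pre := (mu R m * prod_group Fi)%type.
Let pi (u : pre) : baer_sum Ei := baer_pi u.

Let prjE u i : ext_prj (pi u) i = ext_prj (u.2 i).
Proof. exact: (congr1 (fun h => h i) (baer_prjE u)). Qed.

Let piM u v : pi (u * v)%g = (pi u * pi v)%g.
Proof. exact: baer_piM. Qed.

(** In the Baer sum, elements supported at distinct coordinates commute; their images under [f] lie
    over the same points as [x] and [y]. *)
Lemma decomposed_commute (M : subgroup G) : decomposed E H M ->
  forall i j (x y : E), i != j -> subgroup_set (H i) (ext_prj x) ->
  subgroup_set (H j) (ext_prj y) -> commute x y.
Proof.
move=> [f [[fM _ _] _ fprj]] i j x y ij Hx Hy.
pose one : prod_group Fi := 1%g.
pose single k (z : Ei k) : prod_group Fi :=
  @dfwith I (fun i => Ei i) one k z.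
pose mem k (z : E) (Hz : subgroup_set (H k) (ext_prj z)) : Ei k :=
  mem_subgroup (H := preimage_subgroup E (H k)) Hz.
pose lift k (z : E) (Hz : subgroup_set (H k) (ext_prj z)) : baer_sum Ei :=
  pi (1%g, single k (mem k z Hz)).
have liftE k z Hz : ext_prj (\val (f (@lift k z Hz))) = ext_prj z.
  have /= -> := fprj (@lift k z Hz).
  rewrite (eq_bigr (fun l => ext_prj (\val (@single k (mem k z Hz) l)))).
    rewrite (prodg_only (i := k)) => [|l lk]; first by rewrite /single dfwith_in.
    rewrite /single dfwith_out 1?eq_sym //=; exact: ext_prj1.
  by move=> l _; exact: (congr1 val (prjE _ l)).
apply: (commute_ext_prj (esym (liftE i x Hx)) (esym (liftE j y Hy))).
have : commute (lift i x Hx) (lift j y Hy).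
  rewrite /commute -!piM; congr (pi (_, _)); apply: functional_extensionality_dep => k.
  rewrite /= prod_groupM prod_groupM /single; have [e|ki] := eqVneq k i; last first.
    by rewrite dfwith_out 1?eq_sym // mul1g mulg1.
  have kj : j != k by rewrite e eq_sym.
  by rewrite (dfwith_out _ _ kj) mulg1 mul1g.
by move=> /(congr1 f); rewrite !fM => /(congr1 \val).
Qed.

Variable M : subgroup G.
(** The maps [c i] are the coordinates of [M] as internal product of the [H i]; their continuity
    enters that of the inverse isomorphism. *)
Variable c : forall i, subgroup_type M -> subgroup_type (H i).
Hypothesis Etop : topological_ext E.
Hypothesis prod_M : forall h : (forall i, subgroup_type (H i)),
  subgroup_set M (\prod_i \val (h i))%g.
Hypothesis c_prod : forall w, \val w = (\prod_i \val (c i w))%g.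
Hypothesis c_unique : forall (w : subgroup_type M) (h : forall i, subgroup_type (H i)),
  \val w = (\prod_i \val (h i))%g -> forall i, c i w = h i.
Hypothesis c_continuous : forall i, continuous (c i).
Hypothesis E_comm : forall i j (x y : E), i != j ->
  subgroup_set (H i) (ext_prj x) -> subgroup_set (H j) (ext_prj y) -> commute x y.

(** The product map before passing to the quotient that defines the Baer sum. *)
Let amal (u : pre) : E := (ext_inj E u.1 * \prod_i \val (u.2 i))%g.
Let amalg (a : I -> mu R m) : pre :=
  (((\prod_i a i)^-1)%g, fun i => ext_inj (Ei i) (a i)).

Let amalM u v : amal (u * v)%g = (amal u * amal v)%g.
Proof.
rewrite /amal ext_injM (eq_bigr (fun i => \val (u.2 i) * \val (v.2 i))%g) //.
rewrite prodgM_commute ?index_enum_uniq // => [|i j ij].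
  rewrite !mulgA; congr (_ * _)%g; rewrite -!mulgA; congr (_ * _)%g.
  exact: ext_central.
exact: E_comm ij (subgroup_valP (v.2 i)) (subgroup_valP (u.2 j)).
Qed.

Let prj_prod (x : I -> E) : ext_prj (\prod_i x i)%g = (\prod_i ext_prj (x i))%g.
Proof. exact: (big_morph _ (@ext_prjM _ _ E) (ext_prj1 E)). Qed.

Let amal_amalg a : amal (amalg a) = 1%g.
Proof.
rewrite /amal /= -(big_morph _ (@ext_injM _ _ E) (ext_inj1 E)) -ext_injM mulVg.
exact: ext_inj1.
Qed.

Let prj_amal u : ext_prj (amal u) = (\prod_i \val (ext_prj (u.2 i)))%g.
Proof. by rewrite ext_prjM ext_prj_inj mul1g prj_prod. Qed.

Let M_amal u : subgroup_set (preimage_subgroup E M) (amal u).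
Proof. rewrite /= /preimage /= prj_amal; exact: prod_M. Qed.

(** One direction makes the product map well defined on the Baer sum, the other injective. For the
    latter, uniqueness of coordinates shows that the components differ by central factors [a i];
    once these are moved into the [mu] component, the equation in [E] can be cancelled. *)
Let amal_eq u v : pi u = pi v <-> amal u = amal v.
Proof.
split=> [/baer_piP[a ->]|uv]; first by rewrite amalM [X in (_ * X)%g]amal_amalg mulg1.
have uvi i : ext_prj (u.2 i) = ext_prj (v.2 i).
  pose w : subgroup_type M :=
    mem_subgroup (M_amal u : subgroup_set M (ext_prj (amal u))).
  have wu : \val w = (\prod_i \val (ext_prj (u.2 i)))%g by rewrite -prj_amal.
  have wv : \val w = (\prod_i \val (ext_prj (v.2 i)))%g by rewrite -prj_amal -uv.
  by rewrite -(c_unique wu i) -(c_unique wv i).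
pose a i := sval (cid (ext_prj_eq (uvi i))).
have ua i : u.2 i = (ext_inj (Ei i) (a i) * v.2 i)%g.
  exact: (svalP (cid (ext_prj_eq (uvi i)))).
apply/esym/baer_piP; exists a; rewrite -/(amalg a).
have uE : u = (((u.1 * \prod_i a i)%g, v.2) * amalg a)%g.
  rewrite [LHS]surjective_pairing; congr pair; first by rewrite /= -mulgA mulgV mulg1.
  by apply: functional_extensionality_dep => i; rewrite [LHS]ua [LHS]ext_central.
rewrite {1}uE; congr (_ * _)%g.
move: uv; rewrite {1}uE amalM amal_amalg mulg1 /amal /= => /mulIg/ext_inj_injective ->.
by case: (v).
Qed.

Let f (x : baer_sum Ei) : preimage_ext E M :=
  mem_subgroup (M_amal (baer_repr x)).

Let f_pi u : \val (f (pi u)) = amal u.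
Proof. by apply/amal_eq; exact: baer_reprK. Qed.

Let pi_ind (Q : baer_sum Ei -> Prop) : (forall u, Q (pi u)) -> forall x, Q x.
Proof. by move=> Qpi x; rewrite -(baer_reprK x); exact: Qpi. Qed.

Let fM : {morph f : x y / (x * y)%g}.
Proof.
move=> x y; elim/pi_ind: x => u; elim/pi_ind: y => v; apply: val_inj.
by rewrite -piM [LHS]f_pi amalM -2!f_pi.
Qed.

Let f_continuous : continuous f.
Proof.
(* The Baer sum carries the quotient topology. *)
suff fpi : continuous (fun u : pre => f (pi u)).
  by apply/continuousP => A oA; move/continuousP: fpi => /(_ A oA).
move=> u; apply: subgroup_cvg.
have -> : (fun v => \val (f (pi v))) = amal by apply/funext => v; exact: f_pi.
have [Eg ci _ _ _] := Etop; rewrite f_pi; apply: (mulg_cvg Eg).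
  by apply: cvg_comp; [exact: cvg_fst|exact: ci].
apply: (prodg_cvg Eg) => i.
have ui : (fun v : pre => v.2 i) @ u --> u.2 i.
  apply: (cvg_comp (fun v : pre => v.2) (fun x => x i)); first exact: cvg_snd.
  exact: (@prod_group_proj_continuous _ Fi i u.2).
by apply: (cvg_comp _ _ ui); exact: subgroup_val_continuous.
Qed.

Lemma commute_decomposed : decomposed E H M.
Proof.
have f_inj x y : f x = f y -> x = y.
  elim/pi_ind: x => u; elim/pi_ind: y => v fuv.
  by apply/amal_eq; rewrite -!f_pi fuv.
have f_inv (w : preimage_ext E M) : exists u, amal u = \val w.
  pose h i := sval (cid (ext_prj_surjective (Ei i) (c i (ext_prj w)))).
  have hE i : ext_prj (h i) = c i (ext_prj w).
    exact: (svalP (cid (ext_prj_surjective (Ei i) (c i (ext_prj w))))).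
  have : ext_prj (\val w) = ext_prj (amal (1%g, h)).
    rewrite prj_amal [LHS](c_prod (ext_prj w)); apply: eq_bigr => i _.
    by rewrite hE.
  move=> /ext_prj_eq[a ->]; exists (a, h).
  by rewrite /amal /= ext_inj1 mul1g.
pose g w := pi (sval (cid (f_inv w))).
have gK : cancel g f.
  by move=> w; apply: val_inj; rewrite [LHS]f_pi; exact: (svalP (cid (f_inv w))).
have fK : cancel f g by move=> x; apply: f_inj; exact: gK.
have g_continuous (w0 : preimage_ext E M) : g @ w0 --> g w0.
  have FF : Filter (nbhs w0) by exact: nbhs_filter.
  (* [u0] lies over [w0]; local sections through its components will lift the coordinates of points
     near [w0]. *)
  pose u0 := sval (cid (f_inv w0)).
  have u0w0 : amal u0 = \val w0 := svalP (cid (f_inv w0)).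
  have A_discrete : closed (~` [set 1%g : mu R m]).
    exact: (@discrete_closed (discrete_topology (mu R m)) _).
  pose sP i := cid (ext_local_section Etop A_discrete (\val (u0.2 i))).
  pose s i := sval (sP i).
  have sK i h : ext_prj (s i h) = h by rewrite /s; case: (sP i) => t [].
  have s_cvg i : s i @ (\val (ext_prj (u0.2 i))) --> \val (u0.2 i).
    by rewrite /s; case: (sP i) => t [].
  have s_in (w : preimage_ext E M) i :
      subgroup_set (preimage_subgroup E (H i)) (s i (\val (c i (ext_prj w)))).
    by rewrite /= /preimage /= sK; exact: subgroup_valP.
  (* [amal (L w)] and [w] differ by an element of mu tending to 1, hence they
     agree near [w0]. *)
  pose L (w : preimage_ext E M) : pre := (u0.1, fun i => mem_subgroup (s_in w i)).
  have cw0 i : c i (ext_prj w0) = ext_prj (u0.2 i).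
    by apply: (c_unique (h := fun i => ext_prj (u0.2 i))); rewrite -prj_amal u0w0.
  have [Eg ci _ prjC _] := Etop.
  have sL i : (fun w => s i (\val (c i (ext_prj w)))) @ w0 --> \val (u0.2 i).
    have val_cvg : (fun w : preimage_ext E M => \val w) @ w0 --> \val w0.
      exact: subgroup_val_continuous.
    have prj_cvg : (fun w : preimage_ext E M => ext_prj w) @ w0 --> ext_prj w0.
      apply: (@subgroup_cvg _ _ M (nbhs w0) _ (fun w => ext_prj w) (ext_prj w0)).
      exact: (cvg_comp _ _ val_cvg (prjC (\val w0))).
    have c_cvg := cvg_comp _ _ prj_cvg (@c_continuous i _).
    have valc_cvg := cvg_comp _ _ c_cvg (@subgroup_val_continuous _ _ _).
    by apply: (cvg_comp _ _ valc_cvg); rewrite cw0; exact: s_cvg.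
  have L_cvg : L @ w0 --> u0.
    have L2 : (fun w => (L w).2) @ w0 --> u0.2.
      apply: (@prod_group_cvg _ _ Fi (nbhs w0)) => i.
      exact: (@subgroup_cvg _ _ (preimage_subgroup E (H i)) (nbhs w0) _
                (fun w => (L w).2 i) (u0.2 i) (sL i)).
    have L1 : (fun w => (L w).1) @ w0 --> u0.1 by exact: cvg_cst.
    by rewrite [u0]surjective_pairing; exact: (cvg_pair L1 L2).
  have [U [U1 UA]] := ext_inj_isolated Etop A_discrete.
  have near_amal : \forall w \near w0, amal (L w) = \val w.
    have : (fun w => amal (L w) / \val w)%g @ w0 --> (1 : E)%g.
      rewrite -(mulgV (\val w0)); apply: (mulg_cvg Eg); last first.
        by apply: (invg_cvg Eg); exact: subgroup_val_continuous.
      rewrite -u0w0; apply: (mulg_cvg Eg); first exact: cvg_cst.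
      by apply: (prodg_cvg Eg) => i; exact: sL.
    move=> /(_ U U1); apply: (@filterS _ (nbhs w0) FF) => w /=.
    have /ext_prj_eq[a ->] : ext_prj (amal (L w)) = ext_prj (\val w).
      rewrite prj_amal [RHS](c_prod (ext_prj w)); apply: eq_bigr => i _.
      by rewrite /= sK.
    by rewrite mulgK => /UA ->; rewrite ext_inj1 mul1g.
  (* [amal] separates classes, so near [w0] the inverse [g] is [L] followed by the quotient map. *)
  have gL : \forall w \near w0, pi (L w) = g w.
    apply: (@filterS _ (nbhs w0) FF _ _ _ near_amal) => w Lw; apply/amal_eq; rewrite Lw.
    exact/esym/(svalP (cid (f_inv w))).
  apply: cvg_trans (@near_eq_cvg _ _ (nbhs w0) FF _ _ gL) _.
  apply: (cvg_comp _ _ L_cvg).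
  exact: (@pi_continuous pre {eq_quot (baer_equiv Ei)} u0).
exists f; split=> [|a|x].
- by split=> //; exists g; split=> // w0; exact: g_continuous.
- by apply: val_inj; rewrite [LHS]f_pi /amal /= big1 ?mulg1.
- elim/pi_ind: x => u; rewrite -[LHS]/(ext_prj (\val (f (pi u)))) f_pi prj_amal.
  by apply: eq_bigr => i _; exact: (congr1 val (esym (prjE _ i))).
Qed.

End Decomposed.

(** * Coordinates on the Levi subgroups *)

Section MatrixContinuity.
Variable F : localFieldType.

Lemma addf_cvg (S : Type) (T : set_system S) (FF : Filter T) (f g : S -> F) (a b : F) :
  f @ T --> a -> g @ T --> b -> (fun x => f x + g x) @ T --> a + b.
Proof.
apply: (@continuous2_cvg _ _ _ _ T FF f g (fun x y : F => x + y)).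
exact: (@add_continuous F (a, b)).
Qed.

Lemma mulf_cvg (S : Type) (T : set_system S) (FF : Filter T) (f g : S -> F) (a b : F) :
  f @ T --> a -> g @ T --> b -> (fun x => f x * g x) @ T --> a * b.
Proof.
apply: (@continuous2_cvg _ _ _ _ T FF f g (fun x y : F => x * y)).
exact: (@field_mul_continuous F (a, b)).
Qed.

Lemma mx_cvg (S : Type) (T : set_system S) (FF : Filter T) a b
    (f : S -> 'M[F]_(a, b)) (A : 'M[F]_(a, b)) :
  (forall i j, (fun x => f x i j) @ T --> A i j) -> f @ T --> A.
Proof.
move=> fA N [Q AQ QN]; apply: (filterS (P := [set x | forall i j, Q i j (f x i j)])).
  by move=> x xQ; exact: QN.
by apply: filter_forall => i; apply: filter_forall => j; exact: fA.
Qed.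

Lemma mx_coord_continuous a b i j : continuous (fun A : 'M[F]_(a, b) => A i j).
Proof.
move=> A N NA; pose Q k l : set F := if (k == i) && (l == j) then N else setT.
exists Q; last by move=> B /(_ i j); rewrite /Q !eqxx.
by move=> k l; rewrite /Q; case: ifP => [/andP[/eqP-> /eqP->]|_] //; exact: filterT.
Qed.

Lemma sumf_cvg (S I : Type) (T : set_system S) (FF : Filter T) (r : seq I)
    (f : I -> S -> F) (a : I -> F) :
  (forall i, f i @ T --> a i) ->
  (fun x => \sum_(i <- r) f i x) @ T --> \sum_(i <- r) a i.
Proof.
move=> fa; elim: r => [|i r IHr].
  by under eq_fun do rewrite big_nil; rewrite big_nil; exact: cvg_cst.
by under eq_fun do rewrite big_cons; rewrite big_cons; exact: addf_cvg.
Qed.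

Lemma mulmx_continuous a b c (A : 'M[F]_(a, b)) (D : 'M[F]_(a, c)) :
  continuous (fun B : 'M[F]_(b, c) => A *m B + D).
Proof.
move=> B; have FF : Filter (nbhs B) by exact: nbhs_filter.
apply: (mx_cvg FF) => i j.
have -> : (fun B : 'M[F]_(b, c) => (A *m B + D) i j) =
    (fun B => \sum_k A i k * B k j + D i j) by apply/funext => C; rewrite !mxE.
rewrite !mxE; apply: (addf_cvg FF); last exact: cvg_cst.
apply: (sumf_cvg FF) => k; apply: (mulf_cvg FF); first exact: cvg_cst.
exact: mx_coord_continuous.
Qed.

End MatrixContinuity.

Section LinearMapMatrix.
Import VectorInternalTheory.

(** Matrices act on row vectors, hence the reversed order of the factors. *)
Lemma f2mx_affine (F : fieldType) (V : vectType F) (g p k : 'End(V)) :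
  f2mx (g \o p + k)%VF =
  f2mx p *m f2mx g + f2mx k.
Proof.
rewrite -[RHS]/(f2mx (Hom _)); congr f2mx.
apply/lfunP => v; rewrite add_lfunE comp_lfunE !unlock /= mulmxDr linearD mulmxA.
by rewrite r2vK.
Qed.

End LinearMapMatrix.

Section OrthContinuity.
Variables (F : localFieldType) (V : vectType F) (q : {symmetric V}).

(** The two initial topologies are unfolded down to matrices, where composing with [p] and adding
    [k] is affine, hence continuous. *)
Lemma orth_affine_cvg (S : Type) (T : set_system S) (FF : Filter T) (p k : 'End(V))
    (f h : S -> orth q) (a b : orth q) :
  (forall x, h x = (f x \o p + k)%VF :> 'End(V)) -> b = (a \o p + k)%VF :> 'End(V) ->
  f @ T --> a -> h @ T --> b.
Proof.
move=> hE bE fa; do 2 apply: initial_cvgP.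
have -> : @VectorInternalTheory.f2mx F V V \o (@orth_val F V q \o h) =
  (fun x => VectorInternalTheory.f2mx p *m VectorInternalTheory.f2mx (f x) +
             VectorInternalTheory.f2mx k).
  by apply/funext => x /=; rewrite hE f2mx_affine.
rewrite /= bE f2mx_affine.
have f1 : (fun x => orth_val (f x)) @ T --> orth_val a.
  by apply: (cvg_comp _ _ fa); exact: initial_continuous.
have f2 : (fun x => VectorInternalTheory.f2mx (f x)) @ T -->
    VectorInternalTheory.f2mx a.
  by apply: (cvg_comp _ _ f1); exact: initial_continuous.
exact: (cvg_comp _ _ f2 (@mulmx_continuous F _ _ _ _ _ _)).
Qed.

End OrthContinuity.

Section LeviCoordinates.
Variables (F : localFieldType) (V : vectType F) (q : {symmetric V}) (P : levi q).
Implicit Types (g h : orth q) (o : option 'I_(levi_r P)).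

Definition levi_part o : {vspace V} :=
  if o is Some i then (levi_ell i + levi_dual i)%VS else levi_flat P.

Lemma levi_part_eq (f g : 'End(V)) : (forall o, {in levi_part o, f =1 g}) -> f = g.
Proof.
move=> fg; apply: (@levi_eq _ _ _ P) => [i|]; first exact: (fg (Some i)).
exact: (fg None).
Qed.

Lemma levi_part_nondeg o : (levi_part o :&: orthov q (levi_part o) = 0)%VS.
Proof. by case: o => [i|]; [exact: levi_nondeg|exact: levi_nondeg_flat]. Qed.

Lemma levi_part_ortho o o' : o != o' -> (levi_part o <= orthov q (levi_part o'))%VS.
Proof.
case: o o' => [i|] [j|] //= ij.
- by apply: levi_ortho; apply: contraNneq ij => ->.
- exact: levi_ortho_flat.
- rewrite orthov_sym; exact: levi_ortho_flat.
Qed.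

(** The orthogonal projection onto a part; the complement along which it projects contains all other
    parts. *)
Definition levi_proj o : 'End(V) := daddv_pi (levi_part o) (orthov q (levi_part o)).

Lemma levi_proj_id o v : v \in levi_part o -> levi_proj o v = v.
Proof. by move=> vo; rewrite daddv_pi_id // levi_part_nondeg. Qed.

Lemma levi_proj0 o o' v : o != o' -> v \in levi_part o' -> levi_proj o v = 0.
Proof.
rewrite eq_sym => oo' vo'; have v_ortho := subvP (levi_part_ortho oo') _ vo'.
(* The two components of [v] add up to [v], and the one in the orthogonal complement is already
   [v]. *)
have := daddv_pi_add (levi_part_nondeg o) (subvP (addvSr _ _) _ v_ortho).
rewrite (@daddv_pi_id _ _ (orthov q _)) //; last by rewrite capvC levi_part_nondeg.
by move=> /(canRL (addrK _)); rewrite subrr.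
Qed.

Variables (K : subgroup (orth q)) (KO : subgroup_set K `<=` levi_O_set P).
Local Notation M := (internal_prod (levi_factors_comm KO)).
Local Notation H := (levi_factors P K).

Lemma levi_factors_fixes o o' g v :
  subgroup_set (H o) g -> o' != o -> v \in levi_part o' -> g v = v.
Proof.
case: o o' => [i|] [j|] //=.
- by move=> [_ _ gf _] ij; apply: gf; apply: contraNneq ij => ->.
- by move=> [_ _ _ gf] _; apply: gf.
- by move=> /KO[_ gf] _; apply: gf.
Qed.

Lemma levi_factors_stable o g v :
  subgroup_set (H o) g -> v \in levi_part o -> g v \in levi_part o.
Proof.
case: o => [i|] /=; first by move=> gi; exact: (levi_GL_stable gi).
by move=> /KO[gf _]; rewrite -{2}gf; exact: memv_img.
Qed.

(** Factors other than the [o]-th fix this part pointwise, and the [o]-th one preserves it. *)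
Lemma levi_prodE (h : forall o, subgroup_type (H o)) o v : v \in levi_part o ->
  (\prod_o \val (h o) : orth q)%g v = \val (h o) v.
Proof.
move=> vo; set r := index_enum _.
suff: (\prod_(o <- r) \val (h o) : orth q)%g v = if o \in r then \val (h o) v else v.
  by rewrite mem_index_enum.
have : uniq r by exact: index_enum_uniq.
elim: r => [|p r IHr] /=; first by move=> _; rewrite big_nil; exact: id_lfunE.
move=> /andP[pr /IHr {}IHr]; rewrite big_cons [LHS]comp_lfunE {}IHr inE.
have [e|op] /= := eqVneq o p; first by rewrite e (negPf pr).
case: ifP => _; apply: (levi_factors_fixes (subgroup_valP (h p))) (op) _ => //.
exact: (levi_factors_stable (subgroup_valP (h o))).
Qed.

(** Each factor is an affine function of the product, which gives both uniqueness and continuity of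
    the coordinates. *)
Lemma levi_factorE (h : forall o, subgroup_type (H o)) o :
  orth_val (\val (h o)) =
  ((\prod_o \val (h o) : orth q)%g \o levi_proj o + (\1 - levi_proj o))%VF.
Proof.
apply: levi_part_eq => p v vp.
rewrite add_lfunE comp_lfunE add_lfunE opp_lfunE id_lfunE.
have [e|po] := eqVneq o p.
  subst p; rewrite levi_proj_id // subrr addr0; exact/esym/levi_prodE.
rewrite (levi_proj0 po vp) linear0 subr0 add0r.
by apply: (levi_factors_fixes (subgroup_valP (h o))) vp; rewrite eq_sym.
Qed.

Lemma levi_factors_unique (h k : forall o, subgroup_type (H o)) :
  (\prod_o \val (h o) = \prod_o \val (k o))%g -> forall o, h o = k o.
Proof. by move=> hk o; do 2 apply: val_inj; rewrite /= !levi_factorE hk. Qed.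

Definition levi_coord o (w : subgroup_type M) : subgroup_type (H o) :=
  sval (cid (subgroup_valP w)) o.

Lemma levi_coordE w : \val w = (\prod_o \val (levi_coord o w))%g.
Proof. exact: (svalP (cid (subgroup_valP w))). Qed.

Lemma levi_coord_continuous o : continuous (levi_coord o).
Proof.
move=> w; have FF : Filter (nbhs w) by exact: nbhs_filter.
apply: (subgroup_cvg FF).
apply: (@orth_affine_cvg _ _ _ _ _ FF (levi_proj o) (\1 - levi_proj o)%VF
          (fun w => \val w) _ (\val w)).
- by move=> x; rewrite levi_factorE -levi_coordE.
- by rewrite levi_factorE -levi_coordE.
- exact: subgroup_val_continuous.
Qed.

(** Leaving [K] arbitrary inside O(flat) covers M^+ and M at once. *)
Lemma levi_decomposedP (R : realType) (m : nat) (E : central_ext (mu R m) (orth q)) :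
  topological_ext E ->
  decomposed E H M <-> forall o p (x y : E), o != p ->
    subgroup_set (H o) (ext_prj x) -> subgroup_set (H p) (ext_prj y) -> commute x y.
Proof.
move=> Etop; split; first exact: decomposed_commute.
apply: (commute_decomposed (c := levi_coord)) => //.
- by move=> h; exists h.
- exact: levi_coordE.
- by move=> w h; rewrite levi_coordE; exact: levi_factors_unique.
- exact: levi_coord_continuous.
Qed.

End LeviCoordinates.

(** * Isometries of hyperbolic spaces *)

Section SymmetricForm.
Variables (F : fieldType) (V : vectType F) (q : {symmetric V}).

Lemma symmetricC u v : q u v = q v u.
Proof. by rewrite hermC expr0 mul1r. Qed.

Lemma symmetric_suml n (a : 'I_n -> F) (x : 'I_n -> V) v :
  q (\sum_i a i *: x i) v = \sum_i a i * q (x i) v.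
Proof. by rewrite linear_sumlz; apply: eq_bigr => i _; rewrite linearZl_LR. Qed.

Lemma symmetric_sumr n (a : 'I_n -> F) (x : 'I_n -> V) v :
  q v (\sum_i a i *: x i) = \sum_i a i * q v (x i).
Proof.
by rewrite symmetricC symmetric_suml; apply: eq_bigr => i _; rewrite symmetricC.
Qed.

(** A row vector killed by the pairing matrix gives a combination of the [x i] orthogonal to every
    [y j]; the second hypothesis makes it zero, the first its coefficients. *)
Lemma pairing_unitmx n (x y : 'I_n -> V) :
  (forall a : 'I_n -> F, \sum_i a i *: x i = 0 -> forall i, a i = 0) ->
  (forall a : 'I_n -> F, (forall j, q (\sum_i a i *: x i) (y j) = 0) ->
     \sum_i a i *: x i = 0) ->
  \matrix_(i, j) q (x i) (y j) \in unitmx.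
Proof.
move=> xfree nondeg; rewrite -row_free_unit; apply: inj_row_free => a aQ.
apply/rowP => i; rewrite mxE; apply: (xfree (a 0)) => {i}; apply: nondeg => j.
have /rowP/(_ j) := aQ; rewrite !mxE => aQj; rewrite symmetric_suml -[RHS]aQj.
by apply: eq_bigr => i _; rewrite mxE.
Qed.

(** With [A] the matrix of [g] and [B] the invertible Gram matrix of a basis, [A *m B *m A^T = B];
    compare determinants. *)
Lemma det_on_isometry (U : {vspace V}) (g : 'End(V)) :
  (U :&: orthov q U = 0)%VS -> (g @: U <= U)%VS -> isometry q q g ->
  det_on U g ^+ 2 = 1.
Proof.
move=> Unondeg gU gq; pose b (i : 'I_(\dim U)) := (vbasis U)`_i.
have bU i : b i \in U by apply: vbasis_mem; rewrite mem_nth // size_tuple.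
pose B := \matrix_(i, j) q (b i) (b j).
have Bu : B \in unitmx.
  apply: pairing_unitmx => a; first by move/freeP: (basis_free (vbasisP U)); apply.
  move=> aB; apply/eqP; rewrite -memv0 -Unondeg memv_cap memv_suml /=; last first.
    by move=> i _; rewrite memvZ ?bU.
  apply/mem_orthovP => v vU; rewrite (coord_vbasis vU) symmetric_sumr.
  by rewrite big1 // => i _; rewrite aB mulr0.
set A := \matrix_(i, j) coord (vbasis U) j (g (b i)).
have gb i : g (b i) = \sum_j A i j *: b j.
  rewrite (coord_vbasis (subvP gU _ (memv_img g (bU i)))).
  by apply: eq_bigr => j _; rewrite mxE.
have ABA : A *m B *m A^T = B.
  apply/matrixP => i j; rewrite [RHS]mxE -gq !gb symmetric_sumr !mxE.
  apply: eq_bigr => k _; rewrite mulrC mxE symmetric_suml !mxE; congr (_ * _).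
  by apply: eq_bigr => l _; congr (_ * _); rewrite mxE.
have := congr1 determinant ABA.
rewrite !det_mulmx det_tr mulrAC -expr2 -{2}[\det B]mul1r.
by apply: mulIr; rewrite -unitmxE.
Qed.

End SymmetricForm.

(** * SO(flat) inside O(flat) *)

Section LeviSpecial.
Variables (F : localFieldType) (V : vectType F) (q : {symmetric V}) (P : levi q).

Lemma levi_O_det g : levi_O_set P g ->
  det_on (levi_flat P) g = 1 \/ det_on (levi_flat P) g = -1.
Proof.
move=> [gf _]; have /eqP : det_on (levi_flat P) g ^+ 2 = 1.
  apply: (det_on_isometry (levi_nondeg_flat P)); first by rewrite gf.
  exact: orth_isom.
by rewrite sqrf_eq1 => /orP[] /eqP; [left|right].
Qed.

(** Elements of O(flat) outside SO(flat) have determinant -1, and determinants multiply. *)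
Lemma levi_SO_index2 (tau g : orth q) : levi_O_set P tau -> ~ levi_SO_set P tau ->
  levi_O_set P g -> ~ levi_SO_set P g -> levi_SO_set P (g / tau)%g.
Proof.
have detN h : levi_O_set P h -> ~ levi_SO_set P h -> det_on (levi_flat P) h = -1.
  by move=> hO hSO; have [h1|//] := levi_O_det hO; case: hSO.
move=> tO tSO gO gSO; split; first exact: levi_OF.
have hO : levi_O_set P (g / tau)%g by exact: levi_OF.
have := detN g gO gSO; rewrite -{1}[g](divgK tau).
rewrite -[orth_val _]/((g / tau)%g \o tau)%VF.
rewrite det_onM ?(proj1 hO) ?(proj1 tO) //.
by rewrite (detN tau) // mulrN1 => /oppr_inj.
Qed.

End LeviSpecial.

Lemma linear_lfun (F : fieldType) (V : vectType F) (f : V -> V) :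
  linear f -> exists g : 'End(V), g =1 f.
Proof.
move=> f_linear.
pose f' : {linear V -> V} := HB.pack f (GRing.isLinear.Build F V V _ f f_linear).
by exists (linfun f') => v; rewrite lfunE.
Qed.

Section HyperbolicLift.
Variables (F : fieldType) (V : vectType F) (q : {symmetric V}) (n : nat).
Variables (e e' : 'I_n -> V).
Hypothesis q_dual : forall i j, q (e i) (e' j) = (i == j)%:R.
Hypothesis q_e : forall i j, q (e i) (e j) = 0.
Hypothesis q_e' : forall i j, q (e' i) (e' j) = 0.

Definition row_comb (x : 'I_n -> V) (a : 'rV[F]_n) : V := \sum_j a 0 j *: x j.
(** By duality, [row_pair e'] reads off coordinates along [e], and [row_pair e] those along [e']. *)
Definition row_pair (x : 'I_n -> V) (v : V) : 'rV[F]_n := \row_j q v (x j).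

Lemma row_comb_linear x : linear (row_comb x).
Proof.
move=> c a b; rewrite /row_comb scaler_sumr -big_split /=; apply: eq_bigr => j _.
by rewrite !mxE scalerDl scalerA.
Qed.

Lemma row_combD x a b : row_comb x (a + b) = row_comb x a + row_comb x b.
Proof. by have := row_comb_linear x 1 a b; rewrite !scale1r. Qed.

Lemma row_comb0 x : row_comb x 0 = 0.
Proof. by rewrite /row_comb big1 // => j _; rewrite mxE scale0r. Qed.

Lemma row_pair_linear x : linear (row_pair x).
Proof.
move=> c v w; apply/rowP => j.
by rewrite !mxE linearDl linearZl_LR.
Qed.

Lemma row_pairE x a v : q (row_comb x a) v = (a *m (row_pair x v)^T) 0 0.
Proof.
rewrite symmetric_suml !mxE; apply: eq_bigr => j _.
by rewrite !mxE symmetricC.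
Qed.

Lemma row_pair_comb (x y : 'I_n -> V) a :
  row_pair y (row_comb x a) = a *m (\matrix_(i, j) q (x i) (y j)).
Proof.
apply/rowP => j; rewrite !mxE symmetric_suml; apply: eq_bigr => i _.
by rewrite mxE.
Qed.

Let pair_e'e a : row_pair e' (row_comb e a) = a.
Proof.
rewrite row_pair_comb (_ : \matrix_(i, j) _ = 1%:M) ?mulmx1 //.
by apply/matrixP => i j; rewrite !mxE q_dual.
Qed.

Let pair_ee' a : row_pair e (row_comb e' a) = a.
Proof.
rewrite row_pair_comb (_ : \matrix_(i, j) _ = 1%:M) ?mulmx1 //.
by apply/matrixP => i j; rewrite !mxE symmetricC q_dual eq_sym.
Qed.

Let pair_ee a : row_pair e (row_comb e a) = 0.
Proof.
rewrite row_pair_comb (_ : \matrix_(i, j) _ = 0) ?mulmx0 //.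
by apply/matrixP => i j; rewrite !mxE q_e.
Qed.

Let pair_e'e' a : row_pair e' (row_comb e' a) = 0.
Proof.
rewrite row_pair_comb (_ : \matrix_(i, j) _ = 0) ?mulmx0 //.
by apply/matrixP => i j; rewrite !mxE q_e'.
Qed.

Variable A : 'M[F]_n.
Let B := (invmx A)^T.

(* [A] on the span of [e], its contragredient on the span of [e'], and the
   identity on the orthogonal complement of both. *)
Definition hyp_lift v : V := v + row_comb e (row_pair e' v *m A - row_pair e' v)
                               + row_comb e' (row_pair e v *m B - row_pair e v).

Lemma hyp_lift_linear : linear hyp_lift.
Proof.
move=> c v w; rewrite /hyp_lift !row_pair_linear !mulmxDl -!scalemxAl.
have sub (a b a' b' : 'rV[F]_n) :
    c *: a + b - (c *: a' + b') = c *: (a - a') + (b - b').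
  by rewrite opprD addrACA scalerBr.
rewrite !sub !row_comb_linear !scalerDr [c *: v + w + _]addrACA.
by rewrite [LHS]addrACA.
Qed.

Hypothesis Au : A \in unitmx.

Let dot (a b : 'rV[F]_n) : F := (a *m b^T) 0 0.

Let dotC a b : dot a b = dot b a.
Proof. by rewrite /dot -[in RHS](trmxK (b *m a^T)) trmx_mul trmxK [RHS]mxE. Qed.

Let dotBl a b c : dot (a - b) c = dot a c - dot b c.
Proof. by rewrite /dot mulmxBl !mxE. Qed.

Let dotBr a b c : dot c (a - b) = dot c a - dot c b.
Proof. by rewrite /dot linearB /= mulmxBr !mxE. Qed.

Let dot_lift a b : dot (a *m A) (b *m B) = dot a b.
Proof. by rewrite /dot trmx_mul trmxK mulmxA mulmxK. Qed.

(** Both spans are isotropic and [A] paired with its contragredient [B] preserves [dot]; the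
    remaining correction terms cancel by bilinearity and symmetry. *)
Lemma hyp_lift_isometry : isometry q q hyp_lift.
Proof.
move=> v w; rewrite /hyp_lift.
set a := row_pair e' v; set b := row_pair e v.
set a' := row_pair e' w; set b' := row_pair e w.
rewrite !linearDl !linearDr /=.
rewrite !row_pairE !(symmetricC q v) !row_pairE.
have z00 : (0 : 'M[F]_1) 0 0 = 0 by rewrite mxE.
rewrite !pair_ee !pair_e'e' !pair_ee' !pair_e'e !trmx0 !mulmx0 !z00.
rewrite -!/(dot _ _) -/a -/b -/a' -/b'.
rewrite !(dotBl, dotBr) dot_lift (dotC (b *m B) (a' *m A)) dot_lift.
rewrite (dotC (b *m B)) (dotC b) (dotC b).
rewrite (dotC (b' *m B) a) (dotC b' a).
ring.
Qed.

Lemma hyp_lift_comb a : hyp_lift (row_comb e a) = row_comb e (a *m A).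
Proof.
rewrite /hyp_lift pair_e'e pair_ee mul0mx subr0 row_comb0 addr0 -row_combD.
by rewrite addrC subrK.
Qed.

Lemma hyp_lift_id v : (forall j, q v (e j) = 0) -> (forall j, q v (e' j) = 0) ->
  hyp_lift v = v.
Proof.
move=> ve ve'; have e0 : row_pair e v = 0 by apply/rowP => j; rewrite !mxE.
have e'0 : row_pair e' v = 0 by apply/rowP => j; rewrite !mxE.
by rewrite /hyp_lift e0 e'0 !mul0mx subrr !row_comb0 !addr0.
Qed.

(** A vector orthogonal to one of the two families receives only the correction in the span of that
    same family. *)
Lemma hyp_lift_mem (U : {vspace V}) v : v \in U ->
  (forall j, q v (e j) = 0 /\ e j \in U) \/ (forall j, q v (e' j) = 0 /\ e' j \in U) ->
  hyp_lift v \in U.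
Proof.
have combU (x : 'I_n -> V) a : (forall j, x j \in U) -> row_comb x a \in U.
  by move=> xU; apply: memv_suml => j _; rewrite memvZ ?xU.
move=> vU [] h; rewrite /hyp_lift.
  have -> : row_pair e v = 0 by apply/rowP => j; rewrite !mxE (h j).1.
  by rewrite mul0mx subrr row_comb0 addr0 memvD // combU // => j; case: (h j).
have -> : row_pair e' v = 0 by apply/rowP => j; rewrite !mxE (h j).1.
by rewrite mul0mx subrr row_comb0 addr0 memvD // combU // => j; case: (h j).
Qed.

End HyperbolicLift.

(** * Matrices of the elements of GL(ell_i) *)

Section LeviGL.
Variables (F : localFieldType) (V : vectType F) (q : {symmetric V}) (P : levi q).
Hypothesis q_nondeg : nondegenerate q.
Variable i : 'I_(levi_r P).
Local Notation d := (levi_d i).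
Local Notation e := (tnth (levi_basis i)).
Local Notation plane j := (levi_ell j + levi_dual j)%VS.

Let e_ell j : e j \in levi_ell i.
Proof. by apply: (basis_mem (levi_basisP i)); exact: mem_tnth. Qed.

Let comb_inj a : row_comb e a = 0 -> a = 0.
Proof.
move=> ea; apply/rowP => j; rewrite mxE.
have /freeP/(_ (a 0)) := basis_free (levi_basisP i); apply.
by rewrite -[RHS]ea; apply: eq_bigr => k _; rewrite -tnth_nth.
Qed.

(** As [levi_ell i] is isotropic, a vector of it orthogonal to [levi_dual i] is orthogonal to the
    whole nondegenerate plane, hence zero; so the pairing matrix is invertible. *)
Lemma levi_dual_basis : exists e' : 'I_d -> V,
  (forall j, e' j \in levi_dual i) /\ forall j k, q (e j) (e' k) = (j == k)%:R.
Proof.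
pose f (j : 'I_d) := (vbasis (levi_dual i))`_j.
have fdual j : f j \in levi_dual i.
  by apply: vbasis_mem; rewrite mem_nth // size_tuple levi_dim_dual.
pose Q := \matrix_(j, k) q (e j) (f k).
have Qu : Q \in unitmx.
  apply: pairing_unitmx => a.
    move=> ea j; have /rowP/(_ j) : \row_j a j = 0.
      by apply: comb_inj; rewrite -[RHS]ea; apply: eq_bigr => k _; rewrite mxE.
    by rewrite !mxE.
  set x := \sum_i _ => xf; have xl : x \in levi_ell i.
    by apply: memv_suml => j _; rewrite memvZ ?e_ell.
  apply/eqP; rewrite -memv0 -(levi_nondeg i) memv_cap (subvP (addvSl _ _) _ xl) /=.
  apply/mem_orthovP => _ /memv_addP[u ul [w wl ->]]; rewrite linearDr /=.
  rewrite (orthovP (levi_isotropic i)) // add0r (coord_vbasis wl) symmetric_sumr.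
  rewrite big1 // => k _; have := xf (cast_ord (levi_dim_dual i) k).
  by rewrite /f /= => ->; rewrite mulr0.
(* The columns of the inverse pairing matrix give the dual basis. *)
exists (fun k => \sum_l (invmx Q) l k *: f l); split=> [k|j k].
  by apply: memv_suml => l _; rewrite memvZ ?fdual.
rewrite symmetric_sumr; have /matrixP/(_ j k) := mulmxV Qu; rewrite !mxE => <-.
by apply: eq_bigr => l _; rewrite mxE mulrC.
Qed.

(* [A] acts on row vectors of coordinates, hence on the right. *)
Definition levi_matrix (g : orth q) (A : 'M[F]_d) :=
  forall a, g (row_comb e a) = row_comb e (a *m A).

Lemma levi_GL_matrix g : levi_GL_set i g -> exists2 A, A \in unitmx & levi_matrix g A.
Proof.
move=> [gl _ _ _]; pose A := \matrix_(j, k) coord (levi_basis i) k (g (e j)).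
have gA : levi_matrix g A.
  move=> a; rewrite /row_comb linear_sum /=.
  under [LHS]eq_bigr => j _.
    have gj : g (e j) \in levi_ell i by rewrite -gl memv_img ?e_ell.
    rewrite linearZ /= (coord_basis (levi_basisP i) gj) scaler_sumr.
    over.
  rewrite exchange_big /=; apply: eq_bigr => k _; rewrite !mxE scaler_suml.
  by apply: eq_bigr => j _; rewrite !mxE scalerA -tnth_nth.
exists A => //; rewrite -row_free_unit; apply: inj_row_free => a aA.
apply: comb_inj; have := gA a; rewrite aA row_comb0 -[RHS](linear0 g).
by have /lker0P := orth_ker g; apply.
Qed.

Lemma levi_GL_of_matrix A : A \in unitmx ->
  exists2 g, levi_GL_set (P := P) i g & levi_matrix g A.
Proof.
move=> Au; have [e' [e'_dual q_dual]] := levi_dual_basis.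
have q_e j k : q (e j) (e k) = 0 by exact: (orthovP (levi_isotropic i)).
have q_e' j k : q (e' j) (e' k) = 0 by exact: (orthovP (levi_isotropic_dual i)).
have [g gE] := linear_lfun (@hyp_lift_linear _ _ q _ e e' A).
have gq : isometry q q g.
  by move=> v w; rewrite !gE; exact: hyp_lift_isometry.
(* A vector killed by an isometry is orthogonal to everything, hence zero. *)
have gker : lker g == 0%VS.
  rewrite -subv0; apply/subvP => v; rewrite memv_ker => /eqP gv0.
  have <- : orthov q fullv = 0%VS by apply/eqP.
  by apply/mem_orthovP => w _; rewrite -gq gv0 linear0l.
have gP : (lker g == 0%VS) && `[< isometry q q g >] by rewrite gker; apply/asboolP.
have stable (U : {vspace V}) : (forall v, v \in U -> g v \in U) -> (g @: U)%VS = U.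
  move=> gU; apply/eqP; rewrite eqEdim limg_dim_eq ?leqnn ?andbT.
    by apply/subvP => _ /memv_imgP[v vU ->]; exact: gU.
  by rewrite (eqP gker) capv0.
have fixed (U : {vspace V}) : (levi_ell i + levi_dual i <= orthov q U)%VS ->
    {in U, forall v, g v = v}.
  move=> /orthovP iU v vU.
  rewrite gE; apply: hyp_lift_id => j; rewrite symmetricC iU //.
    by rewrite (subvP (addvSl _ _)) ?e_ell.
  by rewrite (subvP (addvSr _ _)).
exists (Orth gP); last first.
  by move=> a /=; rewrite gE; exact: hyp_lift_comb.
split=> [||j ji|] /=.
- apply: stable => v vl; rewrite gE; apply: hyp_lift_mem => //; left=> j.
  by split; [exact: (orthovP (levi_isotropic i))|exact: e_ell].
- apply: stable => v vl; rewrite gE; apply: hyp_lift_mem => //; right=> j.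
  by split; [exact: (orthovP (levi_isotropic_dual i))|exact: e'_dual].
- by apply: fixed; apply: levi_ortho; rewrite eq_sym.
- by apply: fixed; exact: levi_ortho_flat.
Qed.

Lemma levi_matrixM g h A B : levi_matrix g A -> levi_matrix h B ->
  levi_matrix (g * h)%g (B *m A).
Proof. by move=> gA hB a; rewrite [LHS]comp_lfunE hB gA mulmxA. Qed.

Lemma levi_matrixV g A :
  A \in unitmx -> levi_matrix g A -> levi_matrix (g^-1)%g (invmx A).
Proof. by move=> Au gA a; rewrite -{1}(mulmxKV Au a) -gA orthVK. Qed.

Lemma levi_matrix_diag g a : levi_GL_set i g -> levi_matrix g (diag_mx a) ->
  levi_torus i g.
Proof.
move=> gGL ga; split=> // j; exists (a 0 j).
have eE b : row_comb e (b *: delta_mx 0 j) = b *: e j.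
  rewrite /row_comb (bigD1 j) //= big1 => [|k kj].
    by rewrite addr0 !mxE !eqxx mulr1.
  by rewrite !mxE (negPf kj) andbF mulr0 scale0r.
have := ga (1 *: delta_mx 0 j); rewrite eE !scale1r -rowE row_diag_mx => ->.
exact: eE.
Qed.

End LeviGL.

(** In a finite Hausdorff space every set is closed, so 0 would be an open point. *)
Lemma localField_infinite (F : localFieldType) : infinite_set [set: F].
Proof.
move=> finF; apply: (@field_nondiscrete F).
rewrite -[X in open X]setCK openC; apply: accessible_finite_set_closed.1.
  exact/hausdorff_accessible/field_hausdorff.
exact: sub_finite_set finF.
Qed.

Lemma localField_nonzero_inj (F : localFieldType) n :
  exists c : 'I_n -> F, injective c /\ forall i, c i != 0.
Proof.
have inf0 : infinite_set ([set: F] `\ 0).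
  by apply: infinite_setD (finite_set1 0); exact: localField_infinite.
have [B B0 nB] := infinite_set_fset n inf0.
pose s : seq F := finmap.enum_fset B.
have lts (i : 'I_n) : (i < size s)%N by exact: leq_trans nB.
exists (fun i => s`_i); split=> [i j /eqP|i].
  by rewrite nth_uniq //; [move=> /eqP/val_inj|exact: finmap.fset_uniq].
by have [] := B0 s`_i (mem_nth 0 (lts i)); move=> _ /eqP.
Qed.

(** * Vanishing of commutators with [tau] *)

Section CommutatorVanishing.
Variables (F : localFieldType) (charF : 2%N \notin [pchar F]).
Variables (V : vectType F) (q : {symmetric V}) (q_nondeg : nondegenerate q).
Variables (A : preTopologicalGroupType) (E : central_ext A (orth q)).
Variables (P : levi q) (i : 'I_(levi_r P)) (tau : orth q).

(** For [g] commuting with [tau] this is comm([g], [tau]) = 1, in a form that can be manipulated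
    directly on lifts. *)
Definition lifts_commute (g : orth q) := forall x y : E,
  ext_prj x = g -> ext_prj y = tau -> commute x y.

Lemma lifts_commuteM g h :
  lifts_commute g -> lifts_commute h -> lifts_commute (g * h)%g.
Proof.
move=> gC hC x y xgh yt; have [z zh] := ext_prj_surjective E h.
rewrite -(divgK z x); apply/commute_sym/commuteM; apply/commute_sym; last exact: hC.
by apply: gC => //; rewrite ext_prjF xgh zh mulgK.
Qed.

(** Conjugation by a lift [z] of [k] moves [x] to a lift of [g] and [y] to another lift of [tau],
    since [k] commutes with [tau]. *)
Lemma lifts_commuteJ g k : commute k tau -> lifts_commute g ->
  lifts_commute (k^-1 * g * k)%g.
Proof.
move=> kt gC x y xg yt; have [z zk] := ext_prj_surjective E k.
have : commute (z * x / z)%g (z * y / z)%g.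
  apply: gC; rewrite ext_prjF ext_prjM zk ?xg ?yt; last by rewrite kt mulgK.
  by rewrite !mulgA mulgV mul1g mulgK.
rewrite /commute !mulgA !divgK => /mulIg; rewrite -!mulgA; exact: mulgI.
Qed.

Lemma levi_GL_lifts_commute : levi_O_set P tau ->
  (forall t, levi_torus i t -> lifts_commute t) ->
  forall g, levi_GL_set i g -> lifts_commute g.
Proof.
move=> tauO torusC.
(* Quantifying over every [g] with matrix [B] avoids any appeal to the uniqueness of such an
   element. *)
pose Pr B := forall g, levi_GL_set (P := P) i g -> levi_matrix (i := i) g B ->
  lifts_commute g.
suff PrA : forall B, B \in unitmx -> Pr B.
  by move=> g gGL; have [B Bu gB] := levi_GL_matrix gGL; exact: (PrA B).
apply: unitmx_ind => //.
- exact: localField_nonzero_inj.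
- move=> B C Bu Cu PB PC g gGL gBC.
  have [h hGL hB] := levi_GL_of_matrix q_nondeg Bu.
  (* Multiplication of matrices is reversed: [h] has matrix [B] and [g / h] has matrix [C]. *)
  rewrite -(divgK h g); apply: lifts_commuteM; last exact: PB.
  apply: PC; first exact: levi_GLF.
  by have := levi_matrixM gBC (levi_matrixV Bu hB); rewrite mulKmx.
- move=> Q B Qu Bu PB g gGL gQ.
  have [k kGL kQ] := levi_GL_of_matrix q_nondeg Qu.
  have kVGL : levi_GL_set (P := P) i (k^-1)%g by exact: (subgroupV (H := levi_GL i)).
  (* [k^-1 * g * k] has matrix [B], and [g] is recovered by conjugating it back. *)
  have -> : g = ((k^-1)^-1 * (k^-1 * g * k) * k^-1)%g.
    by rewrite invgK !mulgA mulgV mul1g mulgK.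
  apply: lifts_commuteJ; first exact: levi_GLO_comm kVGL tauO.
  apply: PB; first by do 2?[apply: (subgroupM (H := levi_GL i))].
  have := levi_matrixM (levi_matrixM (levi_matrixV Qu kQ) gQ) kQ.
  by rewrite !mulmxA mulmxV // mul1mx mulmxK.
- by move=> a _ g gGL ga; apply: torusC; exact: levi_matrix_diag.
Qed.

End CommutatorVanishing.

(** * The criterion for decomposedness *)

Lemma ext_comm1P (A H : preTopologicalGroupType) (E : central_ext A H) (h1 h2 : H)
    (x1 x2 : E) : commute h1 h2 -> ext_prj x1 = h1 -> ext_prj x2 = h2 ->
  ext_comm E h1 h2 = 1%g <-> commute x1 x2.
Proof.
move=> h12 e1 e2; have cE := ext_commP h12 e1 e2; split=> [c1|x12].
  move: cE; rewrite c1 ext_inj1 => /esym/(congr1 (fun z => z * x2 * x1)%g).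
  by rewrite !divgK mul1g.
by apply: (@ext_inj_injective _ _ E); rewrite cE ext_inj1 x12 mulgK mulgV.
Qed.

Theorem proposition7p1 (R : realType) (F : localFieldType)
    (charF : 2%N \notin [pchar F])
    (V : vectType F) (q : {symmetric V}) (q_nondeg : nondegenerate q)
    (V_neq0 : (fullv : {vspace V}) != 0%VS)
    (m : nat) (m_ge1 : (1 <= m)%N)
    (Gt : central_ext (mu R m) (orth q)) (Gt_top : topological_ext Gt)
    (P : levi q) (flat_neq0 : levi_flat P != 0%VS)
    (tau : orth q) (tau_O : levi_O_set P tau)
    (tau_nSO : ~ levi_SO_set P tau) :
  decomposed Gt (levi_factors P (levi_O P)) (levi_Mplus P) <->
  decomposed Gt (levi_factors P (levi_SO P)) (levi_M P) /\
  (forall (i : 'I_(levi_r P)) (t : orth q),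
     levi_torus i t -> ext_comm Gt t tau = 1%g).
Proof.
split.
  move=> /(levi_decomposedP _ Gt_top) cO; split.
    apply/(levi_decomposedP _ Gt_top) => o p x y op Hx Hy; apply: cO op _ _.
      by case: o Hx => //= -[].
    by case: p Hy => //= -[].
  move=> i t tt; have [x xt] := ext_prj_surjective Gt t.
  have [y yt] := ext_prj_surjective Gt tau.
  apply/(ext_comm1P _ xt yt); first exact: levi_GLO_comm tt.1 tau_O.
  by apply: (cO (Some i) None) => //=; rewrite ?xt ?yt //; exact: tt.1.
move=> [/(levi_decomposedP _ Gt_top) cSO torus1].
have cO (i : 'I_(levi_r P)) (x y : Gt) : levi_GL_set i (ext_prj x) ->
    levi_O_set P (ext_prj y) -> commute x y.
  move=> xi yO; have [ySO|ynSO] := pselect (levi_SO_set P (ext_prj y)).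
    exact: (cSO (Some i) None).
  have [z zt] := ext_prj_surjective Gt tau.
  (* [z] lifts [tau], so [y / z] lies over SO(flat), where (i) applies; it remains to commute [x]
     with [z], which comes from (ii). *)
  rewrite -(divgK z y); apply: commuteM.
    apply: (cSO (Some i) None) => //=; rewrite ext_prjF zt; exact: levi_SO_index2.
  apply: (levi_GL_lifts_commute charF q_nondeg tau_O _ xi) => // t tt u v ut vt.
  by apply/(ext_comm1P _ ut vt); [exact: levi_GLO_comm tt.1 tau_O|exact: torus1 tt].
(* Pairs of distinct GL factors are already covered by the decomposition of the preimage of M. *)
apply/(levi_decomposedP _ Gt_top) => -[i|] [j|] x y //=.
- by move=> ij; exact: (cSO (Some i) (Some j)).
- by move=> _; exact: cO.
- by move=> _ xO yi; apply/commute_sym; exact: cO yi xO.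
Qed.
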